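(* Let $\mathbb{F}_q$ be a finite field with $q$ elements and let $m,d$ be integers with $m>1$ and $1<d<q-1$. Let $S_d$ be the space of homogeneous polynomials of degree $d$ in $\mathbb{F}_q[x_0,x_1,\dots,x_m]$ (including zero). Then the maximum number of common zeros in $\mathbb{P}^m(\mathbb{F}_q)$ that a system of three linearly independent polynomials in $S_d$ can have is $$(d-1)q^{m-1}+p_{m-2}+\lfloor q^{m-3}\rfloor .$$
   Context: For an integer $k$, $p_k:=q^k+q^{k-1}+\dots+q+1$ if $k\ge 0$ and $p_k:=0$ if $k<0$. Linear independence is over $\mathbb{F}_q$. $\lfloor\cdot\rfloor$ denotes the floor function (so $\lfloor q^{m-3}\rfloor=0$ when $m=2$). *)

(* Defs.v *)
From mathcomp Require Import all_boot all_order all_algebra.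
From mathcomp Require Export mpoly.

Set Implicit Arguments.
Unset Strict Implicit.
Unset Printing Implicit Defensive.

Import GRing.Theory.
Local Open Scope ring_scope.

Definition proportional (F : finFieldType) (n : nat) : rel 'rV[F]_n :=
  fun v w => [exists a : F, (a != 0) && (w == a *: v)].

(* P^m(F): a point is the set of its homogeneous coordinate vectors in
   F^(m+1). *)
Definition proj_space (F : finFieldType) (m : nat) : {set {set 'rV[F]_m.+1}} :=
  equivalence_partition (@proportional F m.+1) [set v | v != 0].

(* The library's [dhomog m.+1 F d] is the F-vector space of homogeneous
   polynomials of degree d in m+1 variables, zero included. *)
Definition common_zeros (F : finFieldType) (m d r : nat)
    (f : r.-tuple (dhomog m.+1 F d)) : {set {set 'rV[F]_m.+1}} :=
  [set P in proj_space F m |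
    [forall v in P, [forall i : 'I_r,
       (mpoly_of_dhomog (tnth f i)).@[fun j => v 0 j] == 0]]].

Definition is_max_common_zeros (F : finFieldType) (m d r : nat) (N : int) : Prop :=
  (exists2 f : r.-tuple (dhomog m.+1 F d),
     free f & #|common_zeros f|%:Z = N) /\
  (forall f : r.-tuple (dhomog m.+1 F d),
     free f -> #|common_zeros f|%:Z <= N).

Definition psum (q : nat) (k : int) : nat :=
  if k is Posz n then (\sum_(i < n.+1) q ^ i)%N else 0%N.

(* Main.v *)
From HB Require Import structures.
Require Import Defs.
From mathcomp Require Import all_boot all_order all_algebra.
From mathcomp Require Import finfield zify ring.

(* Work on the affine cone F^(m+1), with q = #|F|, and prove for every
   r-dimensional space W of forms (any r >= 1, 1 < d < q - 1) the bound
   (d-1) q^(m-1) + p_(m-2) + [r <= m] q^(m-r) by induction on m.  Restrict W to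
   hyperplanes.  If it stays of dimension r on all of them, average the bounds
   for the sections.  If all of W vanishes on some hyperplane, divide by its
   equation and use the affine analogue of the bound, proved by the same
   induction over parallel slices.  If a space of dimension at least 2 vanishes
   on some hyperplane, the two quotient forms already have few affine zeros.
   There remains the case where one form a.g vanishes on the hyperplane a = 0.
   The footprint bound for two polynomials shows that either g and some f in W
   have few common affine zeros, or g divides W, so W = g.U with U linear forms;
   then only the at most q^r - 1 nonzero forms of U define degenerate
   hyperplanes, and averaging still works. *)

Set Implicit Arguments.
Unset Strict Implicit.
Unset Printing Implicit Defensive.

Import Order.TTheory GRing.Theory Num.Theory.
Local Open Scope ring_scope.

(** * The footprint bound *)

Section Footprint.
Variables (F : finFieldType) (n : nat).
Implicit Types (p g f : {mpoly F[n]}) (x : 'rV[F]_n) (m a b : 'X_{1..n}).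
Local Notation q := #|F|.

(** Since degrees stay small compared with [q], forms are handled as functions on [F^n]: evaluation
    is injective, restriction to a hyperplane is a linear pullback, and its kernel consists of the
    multiples of the equation of the hyperplane. A restriction can lose dimension, and the
    correction [[r <= m] q^(m-r)] grows when [r] drops. This is why the bound is proved for all [r]
    at once although only three forms are asked for, and why degenerate hyperplanes are the obstacle
    to averaging. When a section loses dimension, the points off the hyperplane are zeros of
    quotients of degree [d - 1], and the lower degree has to pay for the loss. It does so directly
    unless the quotient space is a line spanned by some [g]: then [g] alone may have too many zeros,
    and a second equation from [W] is needed. The main term [(d-1) q^(m-1) + p_(m-2)] is the size of
    a union of [d - 1] hyperplanes through a common subspace of codimension 2, and such a union is
    the fixed part of the extremal systems. *)

Definition mval p x : F := p.@[fun i => x 0 i].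

Definition point_poly x : {mpoly F[n]} :=
  \prod_(i < n) \prod_(c : F | c != x 0 i) ('X_i - c%:MP).

Lemma mval_point_poly x y : (mval (point_poly x) y != 0) = (y == x).
Proof.
rewrite /mval /point_poly rmorph_prod /=.
apply/prodf_neq0/eqP => [h|-> i _].
  apply/rowP => i; have := h i isT; rewrite rmorph_prod /= => /prodf_neq0.
  move/(_ (y 0 i)); rewrite mevalB mevalXU mevalC subrr eqxx => nyx.
  by apply/eqP; apply: contraT => /nyx.
rewrite rmorph_prod /=; apply/prodf_neq0 => c cx.
by rewrite mevalB mevalXU mevalC subr_eq0 eq_sym.
Qed.

(** Every function on [Z] is the evaluation of a polynomial, because the point polynomials give the
    indicators. Reduction by polynomials vanishing on [Z] shows that the monomials with exponents in
    [D] already span all these evaluations, so [#|D|] is at least the dimension [#|Z|]. *)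
Lemma footprint (Z : {set 'rV[F]_n}) (D : {set {ffun 'I_n -> 'I_q}}) :
  (forall m, [forall e in D, [exists i, m i != e i]] ->
     exists g, [/\ g != 0, mlead g = m & {in Z, forall x, mval g x = 0}]) ->
  (#|Z| <= #|D|)%N.
Proof.
move=> hD.
pose mon (e : {ffun 'I_n -> 'I_q}) : 'X_{1..n} := [multinom (e i : nat) | i < n].
pose ev p : 'rV[F]_#|Z| := \row_j mval p (enum_val j).
pose M : 'M[F]_(#|D|, #|Z|) := \matrix_i ev 'X_[mon (enum_val i)].
have evD p1 p2 c : ev (p1 + c *: p2) = ev p1 + c *: ev p2.
  by apply/rowP => j; rewrite !mxE /mval mevalD mevalZ.
have evM p : (ev p <= M)%MS.
  elim/mleadrect: p => p IH.
  have [->|p0] := eqVneq p 0.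
    rewrite (_ : ev 0 = 0) ?sub0mx //.
    by apply/rowP => j; rewrite !mxE /mval meval0.
  (* A multiple of [g] cancels the leading term of [p] and leaves a smaller leading monomial. Such a
     [g] either vanishes on [Z] or is itself a monomial of [D]. *)
  suff [g [g0 lg evg]] : exists g, [/\ g != 0, mlead g = mlead p & (ev g <= M)%MS].
    pose c := mleadc p / mleadc g.
    have gn : mleadc g != 0 by rewrite mleadc_eq0.
    have cn : c != 0 by rewrite mulf_neq0 ?invr_eq0 // mleadc_eq0.
    have -> : p = (p + (- c) *: g) + c *: g by rewrite scaleNr subrK.
    rewrite evD addmx_sub ?scalemx_sub //.
    have [->|r0] := eqVneq (p + (- c) *: g) 0.
      rewrite (_ : ev 0 = 0) ?sub0mx //.
      by apply/rowP => j; rewrite !mxE /mval meval0.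
    apply: IH; rewrite scaleNr in r0 *.
    rewrite lt_neqAle; apply/andP; split.
      apply/negP => /eqP E; move: r0; rewrite -mleadc_eq0 E mcoeffB mcoeffZ.
      by rewrite -lg /c lg divfK ?subrr ?eqxx // -lg.
    rewrite (le_trans (mleadB_le _ _)) // leUx lexx /=.
    by rewrite (le_trans (mleadZ_le _ _)) // lg.
  case: (boolP [forall e in D, [exists i, mlead p i != e i]]) => [/hD|].
    case=> g [g0 lg vg]; exists g; split=> //.
    rewrite (_ : ev g = 0) ?sub0mx //.
    by apply/rowP => j; rewrite !mxE vg // enum_valP.
  rewrite negb_forall_in => /exists_inP [e eD]; rewrite negb_exists => /forallP he.
  have lp : mlead p = mon e.
    by apply/mnmP => i; rewrite mnmE; apply/eqP; have := he i; rewrite negbK.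
  exists 'X_[mlead p]; split; rewrite ?mleadXm // -?msize_poly_eq0 ?msizeX //.
  rewrite lp -(enum_rankK_in eD eD).
  have <- : row (enum_rank_in eD e) M = ev 'X_[mon (enum_val (enum_rank_in eD e))].
    by rewrite rowK.
  exact: row_sub.
have full : row_full M.
  rewrite -sub1mx; apply/row_subP => j; rewrite rowE mulmx1.
  pose z : 'rV[F]_n := enum_val j.
  have zn : mval (point_poly z) z != 0 by rewrite mval_point_poly.
  have -> : delta_mx 0 j = (mval (point_poly z) z)^-1 *: ev (point_poly z).
    apply/rowP => k; rewrite !mxE eqxx /=.
    have [->|kj] := eqVneq k j; first by rewrite mulVf.
    have := mval_point_poly z (enum_val k).
    rewrite (inj_eq enum_val_inj) (negbTE kj) => /negbFE/eqP ->.
    by rewrite mulr0.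
  exact: scalemx_sub.
by have := rank_leq_row M; rewrite (eqP full).
Qed.

End Footprint.

(** * Counting exponents in boxes *)

Lemma card_ord_interval q lo hi :
  (hi <= q)%N -> #|[pred x : 'I_q | (lo <= x < hi)%N]| = (hi - lo)%N.
Proof.
move=> hiq; rewrite -sum1_card -[RHS]muln1 -[RHS]sum_nat_const_nat.
rewrite (big_nat_widen lo hi q) // (big_nat_widenl lo 0) // big_mkord.
by apply: eq_bigl => x; rewrite inE andbC.
Qed.

Lemma card_box n q (lo hi : 'I_n -> nat) : (forall i, hi i <= q)%N ->
  #|[set e : {ffun 'I_n -> 'I_q} | [forall i, (lo i <= e i < hi i)%N]]|
    = (\prod_(i < n) (hi i - lo i))%N.
Proof.
move=> hiq.
transitivity #|family (fun i => [pred x : 'I_q | (lo i <= x < hi i)%N])|.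
  by rewrite cardsE; apply: eq_card => e; rewrite !inE.
rewrite card_family foldrE big_map big_enum /=.
by apply: eq_bigr => i _; exact: card_ord_interval.
Qed.

(** The inequality [prod (1 - a_i/q) >= 1 - sum a_i/q], cleared of denominators; when some
    [a i >= q] the truncated factor is 0 and the sum alone suffices. *)
Lemma leq_expn_prod_sub (I : Type) (r : seq I) (P : pred I) q (a : I -> nat) :
  (q ^ (count P r).+1 <= q * \prod_(i <- r | P i) (q - a i)
                         + (\sum_(i <- r | P i) a i) * q ^ count P r)%N.
Proof.
elim: r => [|i r IH]; first by rewrite !big_nil expn1 muln1 mul0n addn0.
rewrite !big_cons /=; case: (P i) => //=; rewrite add1n.
move: IH; set k := count P r; set S := (\sum_(_ <- _ | _) _)%N.
set p := (\prod_(_ <- _ | _) _)%N => IH.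
rewrite !expnS in IH *; move: (q ^ k)%N IH => t IH.
have [qa|aq] := leqP q (a i).
  have -> : (q - a i = 0)%N by lia.
  rewrite mul0n muln0 add0n mulnDl.
  have : (q * (q * t) <= a i * (q * t))%N by rewrite leq_mul2r qa orbT.
  lia.
have : ((q - a i) * (q * t) <= (q - a i) * (q * p + S * t))%N by rewrite leq_mul2l IH orbT.
have : ((q - a i) * (S * t) <= q * (S * t))%N by rewrite leq_mul2r leq_subr orbT.
rewrite mulnBl; have : (a i * (q * t) <= q * (q * t))%N by rewrite leq_mul2r (ltnW aq) orbT.
nia.
Qed.

Lemma size_index_enum_ord n : size (index_enum 'I_n) = n.
Proof. by rewrite -sum1_size -[RHS]card_ord -sum1_card; apply: eq_bigl. Qed.

(* In exponent space, [v] and [w] bound the sections of the boxes above two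
   leading monomials, whose [i]-th exponents are [A] and [B] and whose other
   exponents add up to [s] and [u]; [t] stands for [q ^ (n - 2)]. *)
Lemma box_gap (q D A B s u v w t : nat) :
    (0 < A)%N -> (B < A)%N -> (A + s < D)%N -> (B + u <= D)%N -> (D < q)%N ->
    (q * t <= v + s * t)%N -> (q * t <= w + u * t)%N ->
  (q * q * t <= (q - A) * v + (A - B) * w + (D - 1) * (q - 1) * t)%N.
Proof.
move=> A0 BA AsD BuD Dq hv hw.
have [s' Es] : exists s', q = (s + s')%N by exists (q - s)%N; lia.
have [u' Eu] : exists u', q = (u + u')%N by exists (q - u)%N; lia.
have hv' : (s' * t <= v)%N by move: hv; rewrite {1}Es mulnDl; lia.
have hw' : (u' * t <= w)%N by move: hw; rewrite {1}Eu mulnDl; lia.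
have h1 : ((q - A) * (s' * t) <= (q - A) * v)%N by rewrite leq_mul2l hv' orbT.
have h2 : ((A - B) * (u' * t) <= (A - B) * w)%N by rewrite leq_mul2l hw' orbT.
have h3 : (q * q <= (q - A) * s' + (A - B) * u' + (D - 1) * (q - 1))%N.
  have e1 : ((q - A) * (q + A + 1 - D) <= (q - A) * s')%N by rewrite leq_mul2l; lia.
  have e2 : ((A - B) * (q + B - D) <= (A - B) * u')%N by rewrite leq_mul2l; lia.
  have e3 : ((A - B) * (1 + B) <= (A - B) * (q + B - D))%N by rewrite leq_mul2l; lia.
  have [b Eb] : exists b, A = (B + 1 + b)%N by exists (A - B - 1)%N; lia.
  have [c Ec] : exists c, D = (A + 1 + c)%N by exists (D - A - 1)%N; lia.
  have [x Ex] : exists x, q = (D + 1 + x)%N by exists (q - D - 1)%N; lia.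
  clear Es Eu hv hw hv' hw' h1 h2.
  subst q D A.
  have := e1; have := e2; have := e3; clear.
  have -> : (B + 1 + b + 1 + c + 1 + x - (B + 1 + b) = 2 + c + x)%N by lia.
  have -> : (B + 1 + b - B = 1 + b)%N by lia.
  have -> : (B + 1 + b + 1 + c - 1 = B + 1 + b + c)%N by lia.
  have -> : (B + 1 + b + 1 + c + 1 + x - 1 = B + b + 2 + c + x)%N by lia.
  have -> : (B + 1 + b + 1 + c + 1 + x + (B + 1 + b) + 1 - (B + 1 + b + 1 + c) =
     B + 1 + b + 2 + x)%N by lia.
  nia.
have := leq_mul2r t (q * q) ((q - A) * s' + (A - B) * u' + (D - 1) * (q - 1)).
rewrite h3 orbT => {}h3; move: h1 h2 h3; rewrite !mulnA !mulnDl; lia.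
Qed.

(** * Affine zeros of one and of two polynomials *)

Section CommonZeros.
Variables (F : finFieldType) (n : nat).
Implicit Types (p g f : {mpoly F[n]}) (x : 'rV[F]_n) (m a b : 'X_{1..n}).
Local Notation q := #|F|.

(** The exponents, all below [q], of the multiples of the monomial [a]: what a leading monomial [a]
    removes from the footprint. *)
Definition upper_box a : {set {ffun 'I_n -> 'I_q}} :=
  [set e : {ffun 'I_n -> 'I_q} | [forall i, (a i <= e i < q)%N]].

Lemma card_exp_box : #|{ffun 'I_n -> 'I_q}| = (q ^ n)%N.
Proof. by rewrite card_ffun !card_ord. Qed.

Lemma card_upper_box a : #|upper_box a| = (\prod_(i < n) (q - a i))%N.
Proof. exact: card_box. Qed.

Lemma vanishing_multiple g m (Z : {set 'rV[F]_n}) :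
    g != 0 -> (mlead g <= m)%MM -> {in Z, forall x, mval g x = 0} ->
  exists g', [/\ g' != 0, mlead g' = m & {in Z, forall x, mval g' x = 0}].
Proof.
move=> g0 le_gm gZ; exists ('X_[m - mlead g] * g); split.
- by rewrite mulf_neq0 // -msize_poly_eq0 msizeX.
- by rewrite mleadM ?mleadXm ?submK // -msize_poly_eq0 msizeX.
- by move=> x /gZ; rewrite /mval mevalM => ->; rewrite mulr0.
Qed.

Lemma card_zeros_footprint (G : seq {mpoly F[n]}) (Z : {set 'rV[F]_n}) :
    {in G, forall g, g != 0 /\ {in Z, forall x, mval g x = 0}} ->
  (#|Z| + #|[set e | has (fun g => e \in upper_box (mlead g)) G]| <= q ^ n)%N.
Proof.
move=> hG; have := cardsC ([set e | has (fun g => e \in upper_box (mlead g)) G]).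
rewrite card_exp_box => <-; rewrite addnC leq_add2l.
apply: footprint => m /forall_inP hm.
case: (boolP [exists i, q <= m i]%N) => [/existsP [i qm]|].
  (* This polynomial vanishes at every point, so monomials with an exponent at least [q] never
     belong to the footprint. *)
  pose g : {mpoly F[n]} := 'X_i ^+ q - 'X_i.
  have lg : mlead g = (U_(i) *+ q)%MM.
    rewrite /g mpolyXn mleadDl mleadXm // mleadN mleadXm.
    apply: lt_mdeg_ltmc; rewrite mdegMn mdeg1 mul1n; exact: finNzRing_gt1.
  have g0 : g != 0.
    rewrite -mleadc_eq0 lg /g mcoeffB mpolyXn !mcoeffX eqxx.
    rewrite (_ : (U_(i) == _)%MM = false) ?subr0 ?oner_eq0 //.
    apply/negP => /eqP/(congr1 mdeg); rewrite mdegMn mdeg1 mul1n => E.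
    by have := finNzRing_gt1 F; rewrite -E.
  apply: (vanishing_multiple g0).
    rewrite lg; apply/mnm_lepP => j; rewrite mulmnE mnm1E.
    by case: eqP => [<-|]; rewrite ?mul1n ?mul0n.
  by move=> x _; rewrite /mval /g mevalB rmorphXn /= mevalXU expf_card subrr.
rewrite negb_exists => /forallP hq.
have mq i : (m i < q)%N by rewrite ltnNge hq.
pose e : {ffun 'I_n -> 'I_q} := [ffun i => Ordinal (mq i)].
have : e \notin ~: [set e | has (fun g => e \in upper_box (mlead g)) G].
  by apply/negP => /hm /existsP [i]; rewrite ffunE eqxx.
rewrite !inE negbK => /hasP /= [g gG]; rewrite inE => /forallP he.
have [g0 gZ] := hG g gG; apply: (vanishing_multiple g0 _ gZ).
by apply/mnm_lepP => i; have /andP[] := he i; rewrite ffunE.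
Qed.

(** The Schwartz-Zippel bound, with a factor [q] on the left so that the exponent [n - 1] does not
    occur. *)
Lemma card_zeros_mpoly p D : p != 0 -> (msize p <= D.+1)%N ->
  (q * #|[set x | mval p x == 0%R]| <= D * q ^ n)%N.
Proof.
move=> p0 sp.
have /= := @card_zeros_footprint [:: p] [set x | mval p x == 0].
rewrite [X in (_ + X <= _)%N](_ : _ = \prod_(i < n) (q - mlead p i))%N => [H|]; last first.
  by rewrite -card_upper_box; apply: eq_card => e; rewrite !inE orbF.
have {}H : (#|[set x | mval p x == 0%R]| + \prod_(i < n) (q - mlead p i) <= q ^ n)%N.
  by apply: H => g; rewrite inE => /eqP ->; split => // x; rewrite inE => /eqP.
have := leq_expn_prod_sub (index_enum 'I_n) predT q (fun i => mlead p i).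
rewrite -mdegE count_predT size_index_enum_ord => H2.
have dp : (mdeg (mlead p) <= D)%N by move: sp; rewrite -mlead_deg.
have : (mdeg (mlead p) * q ^ n <= D * q ^ n)%N by rewrite leq_mul2r dp orbT.
rewrite expnS in H2; move: H H2; set P := (\prod_(_ < _) _)%N => H H2.
have : (q * (#|[set x | mval p x == 0%R]| + P) <= q * q ^ n)%N by rewrite leq_mul2l H orbT.
move: H2; move: (q ^ n)%N (mdeg _ * _)%N => t w; rewrite mulnDr; move: (q * t)%N (q * P)%N (q * #|_|)%N (D * t)%N => *; lia.
Qed.

(** Division stops at the first leading monomial that [mlead g] does not divide. Lower terms of [r]
    may still be divisible, but only [mlead r] enters the footprint. The degree cannot grow because
    the monomial order refines the degree. *)
Lemma mpoly_divide g f : g != 0 ->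
  exists u r, [/\ f = g * u + r, r != 0 -> ~~ (mlead g <= mlead r)%MM
    & (msize r <= msize f)%N].
Proof.
move=> g0; elim/mleadrect: f => f IH.
have [->|f0] := eqVneq f 0.
  by exists 0, 0; rewrite mulr0 addr0 eqxx.
case: (boolP (mlead g <= mlead f)%MM) => [le_gf|ngf]; last first.
  by exists 0, f; rewrite mulr0 add0r; split.
pose h : {mpoly F[n]} := (mleadc f / mleadc g) *: 'X_[mlead f - mlead g].
have gn : mleadc g != 0 by rewrite mleadc_eq0.
have h0 : h != 0.
  rewrite scaler_eq0 negb_or mulf_neq0 ?invr_eq0 ?mleadc_eq0 //=.
  by rewrite -msize_poly_eq0 msizeX.
have lh : mlead h = (mlead f - mlead g)%MM.
  rewrite mleadZ_proper mleadXm // mcoeffX eqxx mulr1.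
  by rewrite mulf_neq0 ?invr_eq0 ?mleadc_eq0.
have lgh : mlead (g * h) = mlead f by rewrite mleadM // lh addmC submK.
have [f1E|f1n] := eqVneq (f - g * h) 0.
  exists h, 0; rewrite addr0 eqxx msize0; split=> //.
  by apply/eqP; rewrite -subr_eq0 f1E.
have lt1 : (mlead (f - g * h) < mlead f)%O.
  rewrite lt_neqAle; apply/andP; split.
    apply/negP => /eqP E; move: f1n; rewrite -mleadc_eq0 E mcoeffB.
    rewrite -{2}lgh mleadM // mleadcM lh mcoeffZ.
    by rewrite mcoeffX eqxx mulr1 mulrC divfK ?subrr ?eqxx.
  by rewrite (le_trans (mleadB_le _ _)) // lgh leUx lexx.
have [u [r [E rN sr]]] := IH _ lt1.
exists (h + u), r; split=> //; first by rewrite mulrDr -addrA -E addrC subrK.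
rewrite (leq_trans sr) // -!mlead_deg //.
by have /lemc_mdeg := ltW lt1.
Qed.

(** The remainder [r] of [f] modulo [g] vanishes at the common zeros. If it is nonzero, the leading
    monomials of [g] and [r] together remove enough exponents. If it is zero, then [f = g * u], and
    either [u] has degree at most 1 or [g] has degree at most [D - 2] and few zeros by itself. *)
Lemma card_common_zeros_mpoly g f D (k : nat) : n = k.+2 ->
    g != 0 -> (msize g <= D)%N -> (msize f <= D.+1)%N -> (D < q)%N ->
  (#|[set x | (mval g x == 0%R) && (mval f x == 0%R)]| <= (D - 1) * (q - 1) * q ^ k)%N
  \/ exists2 u, f = g * u & (msize u <= 2)%N.
Proof.
move=> nE g0 sg sf Dq; set Z := [set x | _].
have q0 : (0 < q)%N by lia.
have sg0 : (0 < msize g)%N by rewrite lt0n msize_poly_eq0.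
have [u [r [fE rN sr]]] := mpoly_divide f g0.
have [r0|r0] := eqVneq r 0; last first.
  left; have {}rN := rN r0.
  have /= := @card_zeros_footprint [:: g; r] Z.
  set U := [set e | _] => H.
  have {}H : (#|Z| + #|U| <= q ^ n)%N.
    apply: H => p; rewrite !inE => /orP[] /eqP ->; split=> // x; rewrite inE => /andP[/eqP gx /eqP fx] //.
    by move: fx; rewrite fE /mval mevalD mevalM -/(mval g x) gx mul0r add0r.
  move: rN; rewrite -[X in ~~ X]/([forall i, mlead g i <= mlead r i]%N).
  rewrite negb_forall => /existsP [i]; rewrite -ltnNge.
  set a := mlead g; set b := mlead r => ba.
  (* [V] is the part of the box above [b] whose [i]-th exponent stays below [a i]; it is disjoint
     from the box above [a], so the two sizes add up. *)
  pose hi j := if j == i then a i else q.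
  pose V : {set {ffun 'I_n -> 'I_q}} := [set e : {ffun 'I_n -> 'I_q} | [forall j, (b j <= e j < hi j)%N]].
  have dg : (mdeg a < D)%N by move: sg; rewrite -mlead_deg.
  have dr : (mdeg b <= D)%N by move: (leq_trans sr sf); rewrite -mlead_deg.
  have aE : mdeg a = (a i + \sum_(j < n | j != i) a j)%N by rewrite mdegE (bigD1 i).
  have bE : mdeg b = (b i + \sum_(j < n | j != i) b j)%N by rewrite mdegE (bigD1 i).
  have cV : #|V| = ((a i - b i) * \prod_(j < n | j != i) (q - b j))%N.
    rewrite card_box => [|j]; last by rewrite /hi; case: eqP => // _; lia.
    rewrite (bigD1 i) //= /hi eqxx; congr (_ * _)%N.
    by apply: eq_bigr => j /negbTE ->.
  have cU : (#|upper_box a| + #|V| <= #|U|)%N.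
    have dis : upper_box a :&: V = set0.
      apply/setP => e; rewrite !inE; apply/negP => /andP[/forallP /(_ i) h1 /forallP /(_ i)].
      by rewrite /hi eqxx; lia.
    rewrite -cardsUI dis cards0 addn0; apply: subset_leq_card; apply/subsetP => e.
    rewrite !inE orbF => /orP[-> //|/forallP he]; apply/orP; right.
    by apply/forallP => j; case/andP: (he j) => h _; apply/andP; split; rewrite ?ltn_ord.
  move: cU; rewrite cV card_upper_box (bigD1 i) //=.
  have hc : count (fun j => j != i) (index_enum 'I_n) = k.+1.
    have := count_predC (pred1 i) (index_enum 'I_n).
    have -> : count (pred1 i) (index_enum 'I_n) = 1%N.
      by rewrite count_uniq_mem ?index_enum_uniq // mem_index_enum.
    rewrite size_index_enum_ord add1n [in RHS]nE => -[<-].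
    exact: eq_count.
  have := leq_expn_prod_sub (index_enum 'I_n) (fun j => j != i) q b.
  have := leq_expn_prod_sub (index_enum 'I_n) (fun j => j != i) q a.
  rewrite hc; set pa := (\prod_(_ <- _ | _) _)%N; set pb := (\prod_(_ <- _ | _) (_ - b _))%N.
  set sa := (\sum_(_ <- _ | _) _)%N in aE *; set sb := (\sum_(_ <- _ | _) _)%N in bE *.
  move=> ha hb hU.
  have simp (s c : nat) : (q ^ k.+2 <= q * c + s * q ^ k.+1 -> q * q ^ k <= c + s * q ^ k)%N.
    rewrite !expnS; set t := (q ^ k)%N => h.
    rewrite -(leq_pmul2l q0); nia.
  have {}ha := simp _ _ ha; have {}hb := simp _ _ hb.
  have A0 : (0 < a i)%N by apply: leq_ltn_trans ba.
  have h1 : (a i + sa < D)%N by rewrite -aE.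
  have h2 : (b i + sb <= D)%N by rewrite -bE.
  have := box_gap A0 ba h1 h2 Dq ha hb.
  rewrite -(mulnA q) -!expnS -nE => hgap.
  rewrite -(leq_add2r #|U|); apply: (leq_trans H); apply: (leq_trans hgap).
  by rewrite addnC leq_add2l.
rewrite r0 addr0 in fE.
have [u0|u0] := eqVneq u 0.
  by right; exists u => //; rewrite u0 msize0.
move: sf; rewrite fE msizeM // => sf.
case: (ltnP (msize g) D) => [sgD|Dsg]; last by right; exists u => //; move: sf Dsg; move: (msize g) (msize u) => x y; lia.
left; have := @card_zeros_mpoly g (D - 2) g0 ltac:(lia).
rewrite (_ : q ^ n = q * (q * q ^ k))%N; last by rewrite nE !expnS.
rewrite (_ : (D - 2) * (q * (q * q ^ k)) = q * ((D - 2) * q * q ^ k))%N; last by rewrite mulnCA !mulnA.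
rewrite leq_pmul2l // => h.
have sub : (#|Z| <= #|[set x | mval g x == 0%R]|)%N.
  by apply: subset_leq_card; apply/subsetP => x; rewrite !inE => /andP[].
apply: (leq_trans sub); apply: (leq_trans h); rewrite leq_mul2r; apply/orP; right.
have [c Ec] : exists c, D = (c + 2)%N by exists (D - 2)%N; lia.
have [y Ey] : exists y, q = (c + 3 + y)%N by exists (q - D - 1)%N; lia.
rewrite Ey Ec addnK (_ : c + 2 - 1 = c + 1)%N; last by lia.
rewrite (_ : c + 3 + y - 1 = c + 2 + y)%N; last by lia.
by rewrite !mulnDl !mulnDr; lia.
Qed.

End CommonZeros.

(** * Functions given by forms *)

Section Forms.
Variable F : finFieldType.
Local Notation fn n := {ffun 'rV[F]_n -> F^o}.

Definition aff n (a : 'cV[F]_n) (c : F) (v : 'rV[F]_n) : F := (v *m a) 0 0 + c.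

Lemma affD n (a : 'cV[F]_n) c v w : aff a c (v + w) = aff a c v + (w *m a) 0 0.
Proof. by rewrite /aff mulmxDl mxE addrAC. Qed.

Lemma aff_lin n (a : 'cV[F]_n) c k v w :
  aff a c (v + k *: w) = aff a c v + k * (w *m a) 0 0.
Proof. by rewrite affD -scalemxAl [in LHS]mxE. Qed.

Definition fmul n (f : fn n) (g : fn n) : fn n := [ffun v => (f v : F) * g v].

Definition affn n (a : 'cV[F]_n) c : fn n := [ffun v => aff a c v].

Definition constf n (c : F) : fn n := [ffun _ => c].

(* Homogeneous of degree [d] if [h], of degree at most [d] otherwise: in the
   latter case the [d] affine factors may be constant. *)
Inductive isform (h : bool) n : nat -> fn n -> Prop :=
| FormConst c : isform h 0 (constf n c)
| FormZero d : isform h d 0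
| FormAdd d f g of isform h d f & isform h d g : isform h d (f + g)
| FormMul d a c f of (h -> c = 0) & isform h d f :
    isform h d.+1 (fmul (affn a c) f).

Lemma fmulE n (f g : fn n) v : fmul f g v = (f v : F) * g v.
Proof. by rewrite ffunE. Qed.

Lemma affnE n (a : 'cV[F]_n) c v : affn a c v = aff a c v.
Proof. by rewrite ffunE. Qed.

Lemma fmul_linear n (f : fn n) : linear (fmul f).
Proof.
by move=> k u v; apply/ffunP => x; rewrite !ffunE /= mulrDr mulrCA.
Qed.
HB.instance Definition _ n (f : fn n) :=
  GRing.isLinear.Build F (fn n) (fn n) _ (fmul f) (fmul_linear f).

Definition pb N n (e : 'rV[F]_N) (B : 'M[F]_(n, N)) (f : fn N) : fn n :=
  [ffun x => f (e + x *m B)].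

Lemma pb_linear N n (e : 'rV[F]_N) (B : 'M[F]_(n, N)) : linear (pb e B).
Proof. by move=> k u v; apply/ffunP => x; rewrite !ffunE. Qed.
HB.instance Definition _ N n (e : 'rV[F]_N) (B : 'M[F]_(n, N)) :=
  GRing.isLinear.Build F (fn N) (fn n) _ (pb e B) (pb_linear e B).

Lemma isformZ h n d (f : fn n) k : isform h d f -> isform h d (k *: f).
Proof.
elim=> {d f} [c|d|d f g _ IHf _ IHg|d a c f hc _ IH].
- rewrite (_ : _ *: _ = constf n (k * c)); first exact: FormConst.
  by apply/ffunP => x; rewrite !ffunE.
- by rewrite scaler0; exact: FormZero.
- by rewrite scalerDr; exact: FormAdd.
- rewrite (_ : _ *: _ = fmul (affn a c) (k *: f)); first exact: FormMul.
  by rewrite linearZ.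
Qed.

Lemma isformB h n d (f g : fn n) : isform h d f -> isform h d g -> isform h d (f - g).
Proof. by move=> hf hg; rewrite -scaleN1r; apply: FormAdd => //; apply: isformZ. Qed.

Lemma isform_sum h n d (I : Type) (r : seq I) (P : pred I) (f : I -> fn n) :
  (forall i, P i -> isform h d (f i)) -> isform h d (\sum_(i <- r | P i) f i).
Proof. by move=> hf; elim/big_ind: _ => //; [exact: FormZero|exact: FormAdd]. Qed.

Lemma isform_affine h n d (f : fn n) : isform h d f -> isform false d f.
Proof.
by elim=> *; [exact: FormConst|exact: FormZero|exact: FormAdd|exact: FormMul].
Qed.

Lemma isform_raise n d k (f : fn n) : isform false d f -> (d <= k)%N -> isform false k f.
Proof.
move=> hf /subnK <-; elim: (k - d)%N => [//|j IH].
rewrite (_ : f = fmul (affn 0 1) f).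
  by rewrite addSn; apply: FormMul.
by apply/ffunP => v; rewrite !ffunE /aff mulmx0 mxE add0r mul1r.
Qed.

Lemma isform_fmul h n d k (f g : fn n) :
  isform h d f -> isform h k g -> isform h (d + k) (fmul f g).
Proof.
move=> hf hg; elim: hf => {d f} [c|d|d f f' _ IHf _ IHf'|d a c f hc _ IH].
- rewrite (_ : fmul _ _ = c *: g); first exact: isformZ.
  by apply/ffunP => x; rewrite !ffunE.
- rewrite (_ : fmul _ _ = 0); first exact: FormZero.
  by apply/ffunP => x; rewrite !ffunE mul0r.
- rewrite (_ : fmul _ _ = fmul f g + fmul f' g); first exact: FormAdd.
  by apply/ffunP => x; rewrite !ffunE mulrDl.
- rewrite (_ : fmul _ _ = fmul (affn a c) (fmul f g)); first exact: FormMul.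
  by apply/ffunP => x; rewrite !ffunE mulrA.
Qed.

Lemma aff_comp N n (a : 'cV[F]_N) c e (B : 'M_(n, N)) x :
  aff a c (e + x *m B) = aff (B *m a) (aff a c e) x.
Proof. by rewrite affD addrC -mulmxA. Qed.

Lemma isform_pb (h : bool) N n d (f : fn N) (e : 'rV[F]_N) (B : 'M[F]_(n, N)) :
  (h -> e = 0) -> isform h d f -> isform h d (pb e B f).
Proof.
move=> he; elim=> {d f} [c|d|d f g _ IHf _ IHg|d a c f hc _ IH].
- rewrite (_ : pb _ _ _ = constf n c); first exact: FormConst.
  by apply/ffunP => x; rewrite !ffunE.
- by rewrite linear0; exact: FormZero.
- by rewrite linearD; exact: FormAdd.
- rewrite (_ : pb _ _ _ = fmul (affn (B *m a) (aff a c e)) (pb e B f)).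
    by apply: FormMul => // hh; rewrite /aff he // mul0mx mxE hc // addr0.
  by apply/ffunP => x; rewrite !ffunE aff_comp.
Qed.

Lemma isform_pb_affine h N n d (f : fn N) (e : 'rV[F]_N) (B : 'M[F]_(n, N)) :
  isform h d f -> isform false d (pb e B f).
Proof. by move=> /isform_affine; exact: isform_pb. Qed.

(** Reduces nonvanishing questions in several variables to counting roots of a univariate
    polynomial, which needs only a degree below the number of parameters [t]. *)
Lemma isform_line h n d (f : fn n) v w : isform h d f ->
  exists2 P : {poly F}, (size P <= d.+1)%N & forall t, f (v + t *: w) = P.[t].
Proof.
elim=> {d f} [c|d|d f g _ [P sP hP] _ [Q sQ hQ]|d a c f hc _ [P sP hP]].
- exists c%:P; first exact: size_polyC_leq1.
  by move=> t; rewrite ffunE hornerC.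
- exists 0; first by rewrite size_poly0.
  by move=> t; rewrite ffunE horner0.
- exists (P + Q); first by rewrite (leq_trans (size_polyD _ _)) // geq_max sP.
  by move=> t; rewrite ffunE hornerD hP hQ.
- exists (((w *m a) 0 0 *: 'X + (aff a c v)%:P) * P).
    rewrite (leq_trans (size_polyMleq _ _)) //.
    have : (size ((w *m a) 0 0 *: 'X + (aff a c v)%:P)%R <= 2)%N.
      rewrite (leq_trans (size_polyD _ _)) // geq_max.
      by rewrite (leq_trans (size_scale_leq _ _)) ?size_polyX // (leq_trans (size_polyC_leq1 _)).
    by move=> sA; rewrite -subn1 leq_subLR (leq_trans (leq_add sA sP)).
  move=> t; rewrite !ffunE hP hornerM; congr (_ * _).
  by rewrite hornerD hornerZ hornerX hornerC aff_lin addrC mulrC.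
Qed.

Lemma isform_homog n d (f : fn n) k v : isform true d f -> f (k *: v) = k ^+ d * f v.
Proof.
elim=> {d f} [c|d|d f g _ IHf _ IHg|d a c f hc _ IH].
- by rewrite !ffunE mul1r.
- by rewrite !ffunE mulr0.
- by rewrite !ffunE IHf IHg mulrDr.
- rewrite !ffunE IH /aff hc // !addr0 -scalemxAl mxE exprS.
  by rewrite mulrACA.
Qed.

(* [v - l(v) e] is the projection onto [l = 0] along [e] when [l(v + te) = l(v) + t]. *)
Lemma isform_division (h : bool) n d (f : fn n) (a : 'cV[F]_n) c (e : 'rV[F]_n) :
    (h -> c = 0) -> isform h d.+1 f ->
  exists2 g : fn n, isform h d g &
    forall v, f v - f (v - aff a c v *: e) = aff a c v * g v.
Proof.
move=> hc hf.
(* Stated for every degree because the induction on [isform] descends to degree 0, where forms are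
   constant and the quotient is 0. *)
suff {hf} H k (f' : fn n) : isform h k f' -> exists2 g : fn n,
    if k is k'.+1 then isform h k' g else g = 0 &
    forall v, f' v - f' (v - aff a c v *: e) = aff a c v * g v.
  by have [g] := H _ _ hf; exists g.
elim=> {d f f' k} [b|d|d f g _ [u hu Eu] _ [w hw Ew]|d b c' f hc' hf [u hu Eu]].
- by exists 0 => // v; rewrite !ffunE subrr mulr0.
- exists 0; first by case: d => // d; exact: FormZero.
  by move=> v; rewrite !ffunE subrr mulr0.
- exists (u + w).
    by case: d hu hw => [-> ->|d]; rewrite ?addr0 //; exact: FormAdd.
  by move=> v; rewrite !ffunE mulrDr -Eu -Ew opprD addrACA.
- pose f0 := pb (- c *: e) (1%:M - a *m e) f.
  have f0E v : f0 v = f (v - aff a c v *: e).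
    rewrite ffunE; congr (f _); rewrite mulmxBr mulmx1 mulmxA /aff.
    rewrite [in LHS](mx11_scalar (v *m a)) mul_scalar_mx scalerDl opprD.
    by rewrite scaleNr [LHS]addrC -addrA.
  have hf0 : isform h d f0.
    by apply: isform_pb => // hh; rewrite hc // oppr0 scale0r.
  (* The product rule: with [l] for [aff a c] and [l'] for [aff b c'], [l' f - (l' - l (e b)) f0 =
     l' (f - f0) + l (e b) f0]. *)
  clearbody f0; exists (fmul (affn b c') u + (e *m b) 0 0 *: f0).
    apply: FormAdd; last exact: isformZ.
    case: d hu {hf0} hf => [-> _|d hu hf]; last exact: FormMul.
    by rewrite linear0; exact: FormZero.
  move=> v; rewrite !fmulE -f0E !affnE -[- (_ *: e)]scaleNr aff_lin ffunE [X in _ = _ * (_ + X)]ffunE fmulE affnE.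
  by rewrite mulrDr mulrCA -Eu -f0E /GRing.scale /=; ring.
Qed.

Lemma isform_mpoly h n d (f : fn n) : isform h d f ->
  exists2 p : {mpoly F[n]}, (msize p <= d.+1)%N & forall v, f v = mval p v.
Proof.
elim=> {d f} [c|d|d f g _ [P sP hP] _ [Q sQ hQ]|d a c f hc _ [P sP hP]].
- exists c%:MP; first by rewrite msizeC; case: (c != 0).
  by move=> v; rewrite ffunE /mval mevalC.
- exists 0; first by rewrite msize0.
  by move=> v; rewrite ffunE /mval meval0.
- exists (P + Q); first by rewrite (leq_trans (msizeD_le _ _)) // geq_max sP.
  by move=> v; rewrite ffunE hP hQ /mval mevalD.
- pose l : {mpoly F[n]} := \sum_(i < n) a i 0 *: 'X_i + c%:MP.
  have sl : (msize l <= 2)%N.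
    rewrite (leq_trans (msizeD_le _ _)) // geq_max; apply/andP; split; last first.
      by rewrite msizeC; case: (c != 0).
    rewrite (leq_trans (msize_sum _ _ _)) //; apply/bigmax_leqP => i _.
    by rewrite (leq_trans (msizeZ_le _ _)) // msizeX mdeg1.
  exists (l * P).
    have [->|l0] := eqVneq l 0; first by rewrite mul0r msize0.
    have [->|P0] := eqVneq P 0; first by rewrite mulr0 msize0.
    by rewrite msizeM // -subn1 leq_subLR (leq_trans (leq_add sl sP)).
  move=> v; rewrite !ffunE hP /mval mevalM; congr (_ * _).
  rewrite mevalD mevalC raddf_sum /= /aff mxE; congr (_ + _).
  by apply: eq_bigr => i _; rewrite mevalZ mevalXU mulrC.
Qed.

Definition feval n (p : {mpoly F[n]}) : fn n := [ffun v => mval p v].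

Lemma isform_monomial n (m : 'X_{1..n}) : isform true (mdeg m) (feval 'X_[m]).
Proof.
suff H : forall d, mdeg m = d -> isform true d (feval 'X_[m]) by exact: H.
move=> d; elim: d m => [|d IH] m.
  move/eqP; rewrite mdeg_eq0 => /eqP ->.
  rewrite (_ : feval _ = constf n 1); first exact: FormConst.
  by apply/ffunP => v; rewrite !ffunE /mval mpolyX0 meval1.
move=> dm.
have [i mi] : exists i, (0 < m i)%N.
  apply/existsP; apply: contraT; rewrite negb_exists => /forallP m0.
  move: dm; rewrite mdegE big1 // => i _; apply/eqP.
  by have := m0 i; rewrite lt0n negbK.
have Em : (m - U_(i) + U_(i))%MM = m.
  by apply: submK; apply/mnm_lepP => j; rewrite mnm1E; case: eqP => // <-.
have dm' : mdeg (m - U_(i)) = d.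
  by apply: succn_inj; rewrite -dm -{2}Em mdegD mdeg1 addn1.
rewrite (_ : feval _ = fmul (affn (delta_mx i 0) 0) (feval 'X_[m - U_(i)])).
  by apply: FormMul => //; exact: IH.
apply/ffunP => v; rewrite !ffunE /mval -{1}Em mpolyXD mevalM mevalXU mulrC.
by rewrite /aff addr0 -colE mxE.
Qed.
End Forms.

(** * Spaces of functions and hyperplane sections *)

Section Spaces.
Variable F : finFieldType.
Local Notation fn n := {ffun 'rV[F]_n -> F^o}.

Definition forms h n d (W : {vspace fn n}) := forall f, f \in W -> isform h d f.

Definition zset n (W : {vspace fn n}) : {set 'rV[F]_n} :=
  [set v | all (fun f : fn n => f v == 0) (vbasis W)].

Lemma zsetP n (W : {vspace fn n}) v :
  reflect (forall f, f \in W -> f v = 0) (v \in zset W).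
Proof.
rewrite inE; apply: (iffP allP) => [h f fW|h f /vbasis_mem fW]; last by rewrite h.
rewrite (coord_vbasis fW) sum_ffunE big1 // => i _.
by rewrite ffunE (eqP (h _ _)) ?scaler0 // mem_nth ?size_tuple.
Qed.

Definition pbL N n (e : 'rV[F]_N) (B : 'M[F]_(n, N)) : 'Hom(fn N, fn n) :=
  linfun (pb e B).
Definition mulL n (f : fn n) : 'End(fn n) := linfun (fmul f).

Lemma forms_pbL (h : bool) N n d (W : {vspace fn N}) (e : 'rV[F]_N) (B : 'M[F]_(n, N)) :
  (h -> e = 0) -> forms h d W -> forms h d (pbL e B @: W)%VS.
Proof.
by move=> he hW f /memv_imgP [g gW ->]; rewrite lfunE /=; apply: isform_pb => //; exact: hW.
Qed.

Lemma zset_pbL N n (W : {vspace fn N}) (e : 'rV[F]_N) (B : 'M[F]_(n, N)) x :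
  (x \in zset (pbL e B @: W)%VS) = (e + x *m B \in zset W).
Proof.
apply/zsetP/zsetP => [h f fW|h f /memv_imgP [g gW ->]].
  by have := h _ (memv_img (pbL e B) fW); rewrite lfunE /= ffunE.
by rewrite lfunE /= ffunE h.
Qed.

Lemma dim_limg_leq N n (L : 'Hom(fn N, fn n)) (W : {vspace fn N}) :
  (\dim (L @: W)%VS <= \dim W)%N.
Proof. by rewrite -(limg_ker_dim L W) leq_addl. Qed.

(** Cofactors are chosen for a basis of [W] only, since an arbitrary choice for each [f] would not
    be linear. Their span has at most [\dim W] generators and maps onto [W], so no dimension is
    gained or lost. *)
Lemma factor_space n (P : fn n -> Prop) (l : fn n) (W : {vspace fn n}) :
    P 0 -> (forall u v, P u -> P v -> P (u + v)) -> (forall k u, P u -> P (k *: u)) ->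
    (forall f, f \in W -> exists2 u, P u & f = fmul l u) ->
  exists W' : {vspace fn n},
    [/\ forall u, u \in W' -> P u, (mulL l @: W')%VS = W & \dim W' = \dim W].
Proof.
move=> P0 PD PZ hW.
have /fin_all_exists2 [U PU UE] i : exists2 u, P u & tnth (vbasis W) i = fmul l u.
  by apply: hW; apply: vbasis_mem; exact: mem_tnth.
pose W' : {vspace fn n} := <<[tuple U i | i < \dim W]>>%VS.
have img : (mulL l @: W')%VS = W.
  rewrite limg_span -[RHS](span_basis (vbasisP W)); congr (span _).
  rewrite [in RHS](tuple_map_ord (vbasis W)) -map_comp; apply: eq_map => i /=.
  by rewrite lfunE /= UE.
exists W'; split=> //.
  move=> u /coord_span ->; elim/big_ind: _ => // i _.
  by rewrite -tnth_nth tnth_mktuple; apply/PZ/PU.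
apply/eqP; rewrite eqn_leq -{2}img dim_limg_leq andbT.
by rewrite (leq_trans (dim_span _)) // size_tuple.
Qed.

(** Affine coordinates on the hyperplane [aff a c = 0], with origin [e] and the rows of [B] as basis
    of directions; restricting functions to the hyperplane becomes [pbL e B]. *)
Definition hyperplane_frame k (a : 'cV[F]_k.+1) c (e : 'rV[F]_k.+1) (B : 'M[F]_(k, k.+1)) :=
  row_free B /\ forall v, aff a c v = 0 <-> exists x, v = e + x *m B.

Lemma direction_exists n (a : 'cV[F]_n) : a != 0 ->
  exists e : 'rV[F]_n, (e *m a) 0 0 = 1.
Proof.
move=> a0; have [i ai] : exists i, a i 0 != 0.
  apply/existsP; apply: contraNT a0; rewrite negb_exists => /forallP h.
  apply/eqP/colP => i; rewrite mxE; apply/eqP; by have := h i; rewrite negbK.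
exists ((a i 0)^-1 *: delta_mx 0 i).
by rewrite -scalemxAl -rowE !mxE mulVf.
Qed.

Lemma frame_exists k (a : 'cV[F]_k.+1) c : a != 0 ->
  exists e B, [/\ hyperplane_frame a c e B & c = 0 -> e = 0].
Proof.
move=> a0; have [w wa] := direction_exists a0.
have [B [fB eB]] : exists B : 'M[F]_(k, k.+1), row_free B /\ (B :=: kermx a)%MS.
  have := eq_row_base (kermx a); have := row_base_free (kermx a).
  have ra : \rank a = 1%N.
    apply/eqP; rewrite eqn_leq rank_leq_col lt0n mxrank_eq0 //.
  have rk : \rank (kermx a) = k by rewrite mxrank_ker ra subn1.
  by move: (row_base _); rewrite rk => B; exists B.
exists (- c *: w), B; split; last by move=> ->; rewrite oppr0 scale0r.
split=> // v; split=> [v0|[x ->]].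
  suff /submxP [x Ex] : ((v + c *: w)%R <= B)%MS.
    by exists x; rewrite -Ex scaleNr addrC addrK.
  rewrite eB sub_kermx; apply/eqP/matrixP => i j; rewrite !ord1 [RHS]mxE.
  by rewrite mulmxDl -scalemxAl mxE [X in _ + X]mxE wa mulr1; move: v0.
have Ba : B *m a = 0 by apply/sub_kermxP; rewrite -eB.
rewrite /aff mulmxDl -mulmxA Ba mulmx0 addr0 -scalemxAl mxE wa mulr1.
exact: addNr.
Qed.

Lemma frame_inj k (a : 'cV[F]_k.+1) c e B : hyperplane_frame a c e B ->
  injective (fun x : 'rV[F]_k => e + x *m B).
Proof.
case=> fB _ x y /addrI /eqP; rewrite -subr_eq0 -mulmxBl.
move/eqP/(congr1 (mulmxr (pinvmx B))); rewrite /= mulmxKp // mul0mx => /eqP.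
by rewrite subr_eq0 => /eqP.
Qed.

Lemma card_zset_hyperplane k (a : 'cV[F]_k.+1) c e B (W : {vspace fn k.+1}) :
  hyperplane_frame a c e B ->
  #|[set v in zset W | aff a c v == 0]| = #|zset (pbL e B @: W)%VS|.
Proof.
move=> hf; have [_ hv] := hf; rewrite -(card_imset _ (frame_inj hf)).
apply: eq_card => v; rewrite inE; apply/andP/imsetP.
  by case=> vW /eqP /hv [x E]; exists x => //; rewrite zset_pbL -E.
case=> x; rewrite zset_pbL => xW ->; split=> //.
by apply/eqP/hv; exists x.
Qed.

(** Rank-nullity for the restriction to a hyperplane: the forms in the kernel are multiples of the
    equation by [isform_division], and [W'] consists of their quotients. *)
Lemma restrict_space (h : bool) k d (a : 'cV[F]_k.+1) c e B (W : {vspace fn k.+1}) :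
    a != 0 -> (h -> c = 0) -> hyperplane_frame a c e B -> forms h d.+1 W ->
  exists W' : {vspace fn k.+1}, [/\ forms h d W',
    (\dim W' + \dim (pbL e B @: W)%VS = \dim W)%N &
    forall u, u \in W' -> fmul (affn a c) u \in W].
Proof.
move=> a0 hc [fB hv] hW.
have [w wa] := direction_exists a0.
have [||//|f|W' [hW' img dW']] := @factor_space _ (isform h d) (affn a c) (W :&: lker (pbL e B))%VS.
- exact: FormZero.
- exact: FormAdd.
- by move=> *; exact: isformZ.
- rewrite memv_cap memv_ker lfunE /= => /andP [fW /eqP f0].
  have [g hg gE] := isform_division a w hc (hW _ fW).
  exists g => //; apply/ffunP => v; rewrite fmulE affnE -gE.
  have /hv [x ->] : aff a c (v - aff a c v *: w) = 0.
    by rewrite -scaleNr aff_lin wa mulr1 subrr.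
  by move/ffunP/(_ x): f0; rewrite !ffunE => ->; rewrite subr0.
exists W'; split=> //; first by rewrite dW' limg_ker_dim.
move=> u uW'; suff : fmul (affn a c) u \in (W :&: lker (pbL e B))%VS.
  by rewrite memv_cap => /andP[].
by rewrite -img -[fmul _ _]lfunE memv_img.
Qed.

Lemma card_zset_restrict k (a : 'cV[F]_k.+1) c e B (W : {vspace fn k.+1}) (Z : {set 'rV[F]_k.+1}) :
    hyperplane_frame a c e B ->
    {in zset W, forall v, aff a c v != 0 -> v \in Z} ->
  (#|zset W| <= #|zset (pbL e B @: W)%VS| + #|Z|)%N.
Proof.
move=> hf hZ; rewrite -(card_zset_hyperplane _ hf).
rewrite -(cardsID [set v | aff a c v == 0] (zset W)) leq_add //.
  by apply: subset_leq_card; apply/subsetP => v; rewrite !inE.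
apply: subset_leq_card; apply/subsetP => v; rewrite inE => /andP [].
by rewrite inE => nv vW; exact: hZ.
Qed.

Lemma dim_zero_fun n (W : {vspace fn n}) : (forall f, f \in W -> f = 0) -> \dim W = 0%N.
Proof.
move=> h; apply/eqP; rewrite dimv_eq0 -subv0; apply/subvP => f /h ->.
exact: mem0v.
Qed.

Lemma dim_gt0_exists n (W : {vspace fn n}) : (0 < \dim W)%N -> exists2 f, f \in W & f != 0.
Proof.
move=> dW; exists (vpick W); first exact: memv_pick.
by rewrite vpick0 -dimv_eq0 -lt0n.
Qed.

End Spaces.

(** * The affine bound *)

(** For [q > 1] this is the floor of [q ^ (n - r)] with an integer exponent, the correction term of
    the bounds. *)
Definition codim_card q n r := if (r <= n)%N then (q ^ (n - r))%N else 0%N.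

Lemma codim_card0 q n : codim_card q n 0 = (q ^ n)%N.
Proof. by rewrite /codim_card subn0. Qed.

Lemma codim_cardSS q n r : codim_card q n.+1 r.+1 = codim_card q n r.
Proof. by rewrite /codim_card ltnS subSS. Qed.

Lemma leq_codim_cardS q n r : (q * codim_card q n r <= codim_card q n.+1 r)%N.
Proof.
rewrite /codim_card; case: (leqP r n) => [rn|_]; last by rewrite muln0.
by rewrite (leqW rn) subSn // expnS.
Qed.

Lemma leq_codim_card q n r s : (0 < q)%N -> (r <= s)%N ->
  (codim_card q n s <= codim_card q n r)%N.
Proof.
move=> q0 rs; rewrite /codim_card; case: (leqP s n) => // sn.
by rewrite (leq_trans rs sn) leq_pexp2l // leq_sub2l.
Qed.

(** Lowering the degree of the quotients by one saves [q * t], which is at least [(d + 2) * t] and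
    pays for [d * t], [A] and [B]. *)
Lemma leq_two_quotients q d t A B C : (0 < d)%N -> (d.+1 < q)%N -> (A <= t)%N ->
  (B <= t)%N -> (d * t + A + ((d - 1) * (q * t) + B) <= d * (q * t) + C)%N.
Proof.
move=> d0 dq At Bt.
have [x Ex] : exists x, d = x.+1 by exists (d - 1)%N; lia.
have [y Ey] : exists y, q = (x + 3 + y)%N by exists (q - x - 3)%N; lia.
subst q d; rewrite subn1 /=; nia.
Qed.

Section Affine.
Variable F : finFieldType.
Local Notation q := #|F|.
Local Notation fn n := {ffun 'rV[F]_n -> F^o}.

Lemma card_field_gt0 : (0 < q)%N.
Proof. exact: ltnW (finNzRing_gt1 F). Qed.
Local Notation q_gt0 := card_field_gt0.

Lemma card_rV n : #|'rV[F]_n| = (q ^ n)%N.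
Proof. by rewrite card_mx mul1n. Qed.

Lemma feval_coef n (p : {mpoly F[n]}) :
  feval p = \sum_(m <- msupp p) p@_m *: feval 'X_[m].
Proof.
apply/ffunP => v; rewrite !ffunE sum_ffunE /mval mevalE.
by apply: eq_bigr => m _; rewrite !ffunE /mval mevalX.
Qed.

Lemma isform_feval_homog n d (p : {mpoly F[n]}) : p \is d.-homog -> isform true d (feval p).
Proof.
move=> /dhomogP hp; rewrite feval_coef big_seq; apply: isform_sum => m mp.
by apply: isformZ; rewrite -(hp _ mp); exact: isform_monomial.
Qed.

Lemma isform_feval n d (p : {mpoly F[n]}) : (msize p <= d.+1)%N -> isform false d (feval p).
Proof.
move=> sp; rewrite feval_coef big_seq; apply: isform_sum => m mp; apply: isformZ.
apply: (@isform_raise _ _ (mdeg m)); first exact: isform_affine (isform_monomial F m).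
by rewrite -ltnS (leq_trans (msize_mdeg_lt mp)).
Qed.

Lemma isform0_const h n (f : fn n) : isform h 0 f -> exists c, f = constf n c.
Proof.
suff H d : isform h d f -> d = 0%N -> exists c, f = constf n c by move=> hf; exact: H hf _.
move=> hf; elim: hf => {d f} [c _|d _|d f g _ IHf _ IHg Ed|//].
- by exists c.
- by exists 0; apply/ffunP => x; rewrite !ffunE.
- have [c ->] := IHf Ed; have [c' ->] := IHg Ed; exists (c + c').
  by apply/ffunP => x; rewrite !ffunE.
Qed.

Lemma zset0_const h n (W : {vspace fn n}) :
  forms h 0 W -> (0 < \dim W)%N -> zset W = set0.
Proof.
move=> hW /dim_gt0_exists [f fW f0]; apply/setP => v; rewrite in_set0; apply/negP => /zsetP/(_ _ fW).
have [c Ec] := isform0_const (hW _ fW); move: f0; rewrite Ec ffunE => + c0.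
by rewrite c0 => /eqP; apply; apply/ffunP => x; rewrite !ffunE.
Qed.

Lemma dim_const_leq h n (W : {vspace fn n}) : forms h 0 W -> (\dim W <= 1)%N.
Proof.
move=> hW; suff /dimvS : (W <= <[constf n 1]>)%VS.
  by move/leq_trans; apply; rewrite dim_vline; case: (_ != 0).
apply/subvP => f /hW /isform0_const [c ->]; apply/vlineP; exists c.
by apply/ffunP => x; rewrite !ffunE; exact: esym (mulr1 _).
Qed.

Lemma card_zeros_form k d (f : fn k.+1) : isform false d f -> f != 0 ->
  (#|[set v | f v == 0%R]| <= d * q ^ k)%N.
Proof.
move=> /isform_mpoly [p sp pE] f0.
have p0 : p != 0.
  by apply: contraNneq f0 => p0; apply/eqP/ffunP => v; rewrite pE p0 ffunE /mval meval0.
rewrite -(leq_pmul2l q_gt0) mulnCA -expnS.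
apply: leq_trans (card_zeros_mpoly p0 sp); rewrite leq_mul2l; apply/orP; right.
by apply: subset_leq_card; apply/subsetP => v; rewrite !inE pE.
Qed.

Lemma card_common_zeros_form k d (g f : fn k.+2) :
    isform false d g -> isform false d.+1 f -> g != 0 -> (d.+1 < q)%N ->
  (#|[set v | (g v == 0%R) && (f v == 0%R)]| <= d * (q - 1) * q ^ k)%N \/
  exists2 u, isform false 1 u & f = fmul g u.
Proof.
move=> /isform_mpoly [p sp pE] /isform_mpoly [r sr rE] g0 dq.
have p0 : p != 0.
  by apply: contraNneq g0 => p0; apply/eqP/ffunP => v; rewrite pE p0 ffunE /mval meval0.
have [h|[u ru su]] := card_common_zeros_mpoly (erefl k.+2) p0 sp sr dq; [left|right].
  rewrite subn1 /= in h; apply: leq_trans h.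
  by apply: subset_leq_card; apply/subsetP => v; rewrite !inE pE rE.
exists (feval u); first exact: isform_feval.
by apply/ffunP => v; rewrite fmulE rE ru pE ffunE /mval mevalM.
Qed.

Lemma zset_subset n (W : {vspace fn n}) f : f \in W -> zset W \subset [set v | f v == 0].
Proof. by move=> fW; apply/subsetP => v /zsetP/(_ _ fW) fv; rewrite inE fv. Qed.

Lemma delta_col_neq0 k : (delta_mx 0 0 : 'cV[F]_k.+1) != 0.
Proof.
by apply/eqP => /colP/(_ 0); rewrite !mxE => /eqP; rewrite oner_eq0.
Qed.

(** The [q] parallel slices with constant first coordinate partition the space, so their bounds add
    up when no slice loses dimension. *)
Lemma slice_dichotomy k (W : {vspace fn k.+1}) M :
    (forall c e B, hyperplane_frame (delta_mx 0 0) c e B ->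
       \dim (pbL e B @: W)%VS = \dim W -> (#|zset (pbL e B @: W)%VS| <= M)%N) ->
  (#|zset W| <= q * M)%N \/ exists c e B, hyperplane_frame (delta_mx 0 0) c e B
       /\ (\dim (pbL e B @: W)%VS < \dim W)%N.
Proof.
move=> hM.
have /fin_all_exists [e_ he] c : exists e : 'rV[F]_k.+1, exists B : 'M[F]_(k, k.+1),
    hyperplane_frame (delta_mx 0 0) (- c) e B.
  by have [e [B [hf _]]] := frame_exists (- c) (delta_col_neq0 k); exists e, B.
have {he} /fin_all_exists [B_ hf] c := he c.
case: (boolP [exists c, \dim (pbL (e_ c) (B_ c) @: W)%VS < \dim W]%N).
  by case/existsP => c hc; right; exists (- c), (e_ c), (B_ c).
rewrite negb_exists => /forallP hd; left.
rewrite -sum1_card (partition_big (fun v : 'rV[F]_k.+1 => v 0 0) predT) //=.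
rewrite -sum_nat_const; apply: leq_sum => c _.
have dE : \dim (pbL (e_ c) (B_ c) @: W)%VS = \dim W.
  by apply/eqP; rewrite eqn_leq dim_limg_leq leqNgt hd.
apply: leq_trans (hM _ _ _ (hf c) dE).
rewrite -(card_zset_hyperplane W (hf c)) sum1_card.
apply: subset_leq_card; apply/subsetP => v /andP[vW /eqP vc]; rewrite in_set vW.
by rewrite /aff -colE mxE vc subrr eqxx.
Qed.

Lemma quotient_subset n (W : {vspace fn n}) (a : 'cV[F]_n) c u :
    fmul (affn a c) u \in W ->
  {in zset W, forall v, aff a c v != 0 -> u v = 0}.
Proof.
move=> uW v /zsetP /(_ _ uW); rewrite fmulE affnE => /eqP.
by rewrite mulf_eq0 => /orP[->|/eqP].
Qed.

Lemma quotient_space_subset n (W W' : {vspace fn n}) (a : 'cV[F]_n) c :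
    (forall u, u \in W' -> fmul (affn a c) u \in W) ->
  {in zset W, forall v, aff a c v != 0 -> v \in zset W'}.
Proof.
move=> hW' v vW av; apply/zsetP => u /hW' uW; exact: quotient_subset uW _ vW av.
Qed.

(** The zero set is an affine subspace of codimension [\dim W], or empty. If a slice loses
    dimension, the quotients are constants: exactly one dimension is lost, and a nonzero constant
    among them leaves no zeros off the slice. *)
Lemma card_zset_degree1 n (W : {vspace fn n}) : forms false 1 W ->
  (#|zset W| <= codim_card q n (\dim W))%N.
Proof.
elim: n W => [|k IH] W hW.
  have [dW|] := posnP (\dim W).
    by rewrite dW codim_card0 (leq_trans (max_card _)) // card_rV.
  case/dim_gt0_exists => f fW f0.
  rewrite (_ : zset W = set0) ?cards0 //; apply/setP => v; rewrite in_set0.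
  apply/negP => /zsetP /(_ _ fW) fv; move/eqP: f0; apply; apply/ffunP => x.
  by rewrite (_ : x = v) ?fv ?ffunE //; apply/rowP; case.
have /slice_dichotomy [h|[c [e [B [hf dlt]]]]] : forall c e B,
    hyperplane_frame (delta_mx 0 0) c e B -> \dim (pbL e B @: W)%VS = \dim W ->
    (#|zset (pbL e B @: W)%VS| <= codim_card q k (\dim W))%N.
- by move=> c e B hf dE; rewrite -dE; apply: IH; exact: forms_pbL.
- by apply: (leq_trans h); exact: leq_codim_cardS.
have [//|W' [hW' dE uW]] := restrict_space (delta_col_neq0 k) _ hf hW.
have dW' : (\dim W' <= 1)%N := dim_const_leq hW'.
have dW'0 : (0 < \dim W')%N by move: dlt dE; lia.
have W'0 := zset0_const hW' dW'0.
have := card_zset_restrict hf (quotient_space_subset uW).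
rewrite W'0 cards0 addn0 => /leq_trans; apply.
have -> : \dim W = (\dim (pbL e B @: W)%VS).+1 by move: dE dW' dW'0; lia.
by rewrite codim_cardSS; apply: IH; apply: forms_pbL.
Qed.

(** Evaluation at [v] is the pullback to the one-point space ['rV_0], so its image has dimension at
    most 1. *)
Lemma exists_vanishing_at n (W : {vspace fn n}) v : (1 < \dim W)%N ->
  exists f, [/\ f \in W, f != 0 & f v = 0].
Proof.
move=> dW; have := limg_ker_dim (pbL v (0 : 'M[F]_(0, n))) W.
have : (\dim (pbL v (0 : 'M[F]_(0, n)) @: W)%VS <= 1)%N.
  rewrite (leq_trans (dimvS (subvf _))) // dimvf.
  by rewrite /dim /= card_rV.
move=> d1 dE; have [] := @dim_gt0_exists _ _ (W :&: lker (pbL v (0 : 'M[F]_(0, n))))%VS.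
  rewrite lt0n; apply/eqP => z; move: dE; rewrite z add0n => E.
  by rewrite E leqNgt dW in d1.
move=> f; rewrite memv_cap memv_ker lfunE /= => /andP [fW /eqP f0] fn0.
exists f; split=> //; move/ffunP/(_ 0): f0; rewrite !ffunE.
by rewrite mulmx0 addr0.
Qed.

Lemma factor_common h n d (W : {vspace fn n}) (g : fn n) :
    (forall f, f \in W -> exists2 u, isform h d u & f = fmul g u) ->
  exists U : {vspace fn n},
    [/\ forms h d U, (mulL g @: U)%VS = W & \dim U = \dim W].
Proof.
apply: factor_space; first exact: FormZero.
  by move=> *; exact: FormAdd.
by move=> *; exact: isformZ.
Qed.

(** The induction on [k] bounds the slices; the inner one on [d] bounds the quotients by the
    equation of a slice, which live on the same space in lower degree. *)
Theorem card_zset_affine k d (W : {vspace fn k.+1}) :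
    (d < q)%N -> forms false d W -> (0 < \dim W)%N ->
  (#|zset W| <= (d - 1) * q ^ k + codim_card q k.+1 (\dim W))%N.
Proof.
elim: k d W => [|k IHk] d W.
  case: (leqP d 1) => [d1|d1] dq hW dW.
    have hW1 : forms false 1 W by move=> f fW; apply: isform_raise (hW _ fW) d1.
    by rewrite (leq_trans (card_zset_degree1 hW1)) // leq_addl.
  have [f fW f0] := dim_gt0_exists dW.
  have Wd : (#|zset W| <= d)%N.
    have := card_zeros_form (hW _ fW) f0; rewrite expn0 muln1.
    by apply: leq_trans; apply: subset_leq_card; exact: zset_subset.
  have [dE|dE] : \dim W = 1%N \/ (1 < \dim W)%N by move: dW; lia.
    by rewrite dE /codim_card /= expn0 !muln1 subnK // ltnW.
  (* In one variable, two independent forms cost a zero: a nonzero element of [W] vanishing at some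
     [v] outside the common zeros has at most [d.+1] zeros, and [v] is one of them. *)
  have [v vW] : exists v, v \notin zset W.
    apply/existsP; apply: contraTT dq; rewrite negb_exists => /forallP hv.
    rewrite -leqNgt (leq_trans _ Wd) // -[X in (X <= _)%N]expn1 -card_rV -cardsT.
    by apply: subset_leq_card; apply/subsetP => v _; have := hv v; rewrite negbK.
  have [f' [f'W f'0 f'v]] := exists_vanishing_at v dE.
  have := card_zeros_form (hW _ f'W) f'0; rewrite expn0 !muln1.
  have : (#|v |: zset W| <= #|[set x | f' x == 0%R]|)%N.
    apply: subset_leq_card; rewrite subUset sub1set inE f'v eqxx /=.
    exact: zset_subset.
  rewrite cardsU1 vW => h1 /(leq_trans h1) h.
  by rewrite (leq_trans _ (leq_addr _ _)) // leq_subRL // ltnW.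
elim: d W => [|d IHd] W dq hW dW.
  by rewrite (zset0_const hW dW) cards0.
have [d0|d0] := posnP d.
  rewrite d0 in hW *.
  by rewrite (leq_trans (card_zset_degree1 hW)) // leq_addl.
have /slice_dichotomy [h|[c [e [B [hf dlt]]]]] : forall c e B,
    hyperplane_frame (delta_mx 0 0) c e B -> \dim (pbL e B @: W)%VS = \dim W ->
    (#|zset (pbL e B @: W)%VS| <= d * q ^ k + codim_card q k.+1 (\dim W))%N.
- move=> c e B hf dE; rewrite -dE; have := IHk d.+1 (pbL e B @: W)%VS dq; rewrite subn1 /=; apply.
    exact: forms_pbL.
  by rewrite dE.
- apply: (leq_trans h); rewrite subn1 /= mulnDr mulnCA -expnS leq_add2l.
  exact: leq_codim_cardS.
have [//|W' [hW' dE uW]] := restrict_space (delta_col_neq0 k.+1) _ hf hW.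
have dW'0 : (0 < \dim W')%N by move: dlt dE; lia.
have hS : forms false d.+1 (pbL e B @: W)%VS by apply: forms_pbL.
have b2 := IHd W' (ltnW dq) hW' dW'0.
rewrite subn1 /=.
(* If all of [W] vanishes on the slice, all its [q ^ k.+1] points may be zeros, but [W'] has the
   full dimension and one degree less saves exactly that number. *)
have [t0|t0] := posnP (\dim (pbL e B @: W)%VS).
  apply: (leq_trans (card_zset_restrict hf (quotient_space_subset uW))).
  rewrite t0 addn0 in dE; rewrite -dE.
  have b1 : (#|zset (pbL e B @: W)%VS| <= q ^ k.+1)%N by rewrite -card_rV max_card.
  have -> : (d * q ^ k.+1 = q ^ k.+1 + (d - 1) * q ^ k.+1)%N.
    by rewrite -mulSn; congr (_ * _)%N; lia.
  by rewrite -addnA leq_add.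
have b1 := IHk _ _ dq hS t0; rewrite subn1 /= in b1.
have [s2|s1] : (1 < \dim W')%N \/ \dim W' = 1%N by move: dW'0; lia.
  apply: (leq_trans (card_zset_restrict hf (quotient_space_subset uW))).
  have c1 := leq_codim_card k.+1 q_gt0 t0.
  have c2 := leq_codim_card k.+2 q_gt0 s2.
  rewrite codim_cardSS codim_card0 in c1; rewrite !codim_cardSS codim_card0 in c2.
  apply: (leq_trans (leq_add b1 b2)).
  rewrite expnS; exact: leq_two_quotients.
have [g gW' g0] := dim_gt0_exists dW'0.
set Z := [set v in zset W | g v == 0].
have sub : {in zset W, forall v, aff (delta_mx 0 0) c v != 0 -> v \in Z}.
  by move=> v vW av; rewrite inE vW (quotient_subset (uW _ gW') vW av) eqxx.
have tE : \dim W = (\dim (pbL e B @: W)%VS).+1 by move: dE s1; lia.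
have [Zle|Zgt] := leqP #|Z| (d * (q - 1) * q ^ k).
  apply: (leq_trans (card_zset_restrict hf sub)).
  apply: (leq_trans (leq_add b1 Zle)).
  rewrite addnAC -mulnA -mulnDr tE !codim_cardSS leq_add2r leq_mul2l; apply/orP; right.
  by rewrite expnS mulnBl mul1n subnKC // leq_pmull // q_gt0.
have [U [hU gU dU]] : exists U : {vspace fn k.+2},
    [/\ forms false 1 U, (mulL g @: U)%VS = W & \dim U = \dim W].
  apply: factor_common => f fW.
  have [hle|//] := card_common_zeros_form (hW' _ gW') (hW _ fW) g0 dq.
  move: Zgt; rewrite ltnNge (leq_trans _ hle) //.
  apply: subset_leq_card; apply/subsetP => v /setIdP [/zsetP/(_ _ fW) fv gv].
  by rewrite in_set gv fv eqxx.
(* A zero of [W = g U] is a zero of [g], which accounts for the main term, or of the affine forms in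
   [U], which accounts for the correction. *)
rewrite -dU; apply: leq_trans (leq_add (card_zeros_form (hW' _ gW') g0) (card_zset_degree1 hU)).
rewrite -cardsUI (leq_trans _ (leq_addr _ _)) //.
apply: subset_leq_card; apply/subsetP => v /zsetP vW; rewrite inE.
case: (boolP (g v == 0)) => gv; first by rewrite inE gv.
apply/orP; right; apply/zsetP => u uU.
have : fmul g u v = 0 by apply: vW; rewrite -gU -[fmul _ _]lfunE memv_img.
by rewrite fmulE => /eqP; rewrite mulf_eq0 (negbTE gv) => /eqP.
Qed.
End Affine.

(** * Cones *)

Section Cones.
Variable F : finFieldType.
Local Notation q := #|F|.
Local Notation fn n := {ffun 'rV[F]_n -> F^o}.
Local Notation q_gt0 := (card_field_gt0 F).

Lemma card_nonzero : #|[set a : F | a != 0%R]| = (q - 1)%N.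
Proof. by rewrite cardsE cardC1 subn1. Qed.

Lemma proportional_equiv n : equivalence_rel (@proportional F n).
Proof.
move=> x y z; split.
  by apply/existsP; exists 1; rewrite oner_eq0 scale1r eqxx.
case/existsP => a /andP[a0 /eqP ->]; apply/existsP/existsP => -[b /andP[b0 /eqP ->]].
  exists (b / a); rewrite mulf_neq0 ?invr_eq0 //=.
  by rewrite scalerA divfK.
by exists (b * a); rewrite mulf_neq0 //= scalerA.
Qed.

Lemma proj_space_partition m : partition (proj_space F m) [set v : 'rV[F]_m.+1 | v != 0].
Proof. by apply: equivalence_partitionP => x y z _ _ _; exact: proportional_equiv. Qed.

Lemma proj_point_mem m (P : {set 'rV[F]_m.+1}) v : P \in proj_space F m -> v \in P ->
  v != 0 /\ P = [set a *: v | a in [set a : F | a != 0%R]].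
Proof.
case/imsetP => x; rewrite inE => x0 ->; rewrite inE => /andP[]; rewrite inE => v0.
case/existsP => a /andP[a0 /eqP Ev]; split=> //.
apply/setP => y; rewrite !inE; apply/andP/imsetP.
  case=> y0 /existsP[b /andP[b0 /eqP ->]]; exists (b / a).
    by rewrite inE mulf_neq0 ?invr_eq0.
  by rewrite Ev scalerA divfK.
case=> b; rewrite inE => b0 ->; split; first by rewrite scaler_eq0 negb_or b0.
by apply/existsP; exists (b * a); rewrite mulf_neq0 //= Ev scalerA.
Qed.

Lemma card_proj_point m (P : {set 'rV[F]_m.+1}) : P \in proj_space F m -> #|P| = (q - 1)%N.
Proof.
move=> hP; have /and3P [_ _ n0] := proj_space_partition m.
have [P0|[v vP]] := set_0Vmem P; first by move: n0; rewrite -P0 hP.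
have [v0 ->] := proj_point_mem hP vP; rewrite card_imset ?card_nonzero //.
move=> a b /= /eqP; rewrite -subr_eq0 -scalerBl scaler_eq0 (negbTE v0) orbF.
by rewrite subr_eq0 => /eqP.
Qed.

Definition cone n (Z : {set 'rV[F]_n}) := forall k v, v \in Z -> k *: v \in Z.

Lemma card_cone m (Z : {set 'rV[F]_m.+1}) : cone Z ->
  #|Z :\ 0| = (#|[set P in proj_space F m | P \subset Z]| * (q - 1))%N.
Proof.
move=> hZ; apply: card_uniform_partition => [P|].
  by rewrite inE => /andP[/card_proj_point].
have /and3P [/eqP covE triv n0] := proj_space_partition m.
apply/and3P; split; last by rewrite inE (negbTE n0).
  apply/eqP/setP => v; rewrite !inE; apply/bigcupP/andP.
    case=> P; rewrite inE => /andP[hP /subsetP PZ] vP; split; last exact: PZ.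
    by case: (proj_point_mem hP vP).
  case=> v0 vZ; have : v \in cover (proj_space F m) by rewrite covE inE.
  case/bigcupP => P hP vP; exists P => //; rewrite inE hP.
  apply/subsetP => w; have [_ ->] := proj_point_mem hP vP.
  by case/imsetP => a _ ->; exact: hZ.
by apply: trivIsetS triv; apply/subsetP => P; rewrite inE => /andP[].
Qed.

Lemma cone_zset d n (W : {vspace fn n}) : forms true d W -> cone (zset W).
Proof.
move=> hW k v /zsetP vW; apply/zsetP => f fW.
by rewrite (isform_homog _ _ (hW _ fW)) vW ?mulr0.
Qed.

Lemma zset_at0 d n (W : {vspace fn n}) : forms true d.+1 W -> 0 \in zset W.
Proof.
move=> hW; apply/zsetP => f fW.
by rewrite -(scale0r (0 : 'rV[F]_n)) (isform_homog _ _ (hW _ fW)) exprS !mul0r.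
Qed.

Lemma isform_affn (h : bool) n (a : 'cV[F]_n) c : (h -> c = 0) -> isform h 1 (affn a c).
Proof.
move=> hc; rewrite (_ : affn a c = fmul (affn a c) (constf n 1)).
  by apply: FormMul => //; exact: FormConst.
by apply/ffunP => v; rewrite fmulE !ffunE mulr1.
Qed.

Lemma isform1_affn (h : bool) n (f : fn n) : isform h 1 f ->
  exists a c, (h -> c = 0) /\ f = affn a c.
Proof.
suff H d : isform h d f -> d = 1%N -> exists a c, (h -> c = 0) /\ f = affn a c.
  by move=> hf; exact: H hf _.
move=> hf; elim: hf => {d f} [//|d _|d f g _ IHf _ IHg Ed|d a c f hc hf _ [d0]].
- exists 0, 0; split=> //; apply/ffunP => v.
  by rewrite affnE /aff mulmx0 !mxE addr0 ffunE.
- have [a [c [hc ->]]] := IHf Ed; have [b [c' [hc' ->]]] := IHg Ed.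
  exists (a + b), (c + c'); split; first by move=> hh; rewrite hc // hc' // addr0.
  apply/ffunP => v; rewrite [in LHS]ffunE !affnE /aff mulmxDr [in RHS]mxE addrACA.
  by [].
- move: hf; rewrite d0 => /isform0_const [b ->].
  exists (b *: a), (b * c); split; first by move=> hh; rewrite hc // mulr0.
  apply/ffunP => v; rewrite fmulE !affnE ffunE /aff -scalemxAr [in RHS]mxE.
  by rewrite mulrDl mulrC [c * _]mulrC.
Qed.

(** On the line joining a nonzero of [f] to a nonzero of [g], both restrict to nonzero polynomials,
    and their product has too small a degree to vanish at all [q] parameters. *)
Lemma fmul_neq0 h h' n d d' (f g : fn n) : isform h d f -> isform h' d' g ->
  (d + d' < q)%N -> f != 0 -> g != 0 -> fmul f g != 0.
Proof.
move=> hf hg dq.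
have nz (u : fn n) : u != 0 -> exists v, u v != 0.
  move=> u0; apply/existsP; apply: contraNT u0; rewrite negb_exists => /forallP hu.
  by apply/eqP/ffunP => v; rewrite ffunE; apply/eqP; have := hu v; rewrite negbK.
move=> /nz [v fv] /nz [w gw].
have [P sP hP] := isform_line v (w - v) hf.
have [Q sQ hQ] := isform_line v (w - v) hg.
have P0 : P != 0.
  by apply: contraNneq fv => P0; have := hP 0; rewrite scale0r addr0 P0 horner0 => ->.
have Q0 : Q != 0.
  apply: contraNneq gw => Q0.
  by have := hQ 1; rewrite scale1r addrC subrK Q0 horner0 => ->.
apply/negP => /eqP fg0.
have := @max_poly_roots _ (P * Q) (enum F) (mulf_neq0 P0 Q0) _ (enum_uniq _).
rewrite size_mul // -cardE => H.
have : (q < (size P + size Q).-1)%N.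
  apply: H; apply/allP => t _; rewrite /root hornerM -hP -hQ.
  by move/ffunP/(_ (v + t *: (w - v))): fg0; rewrite fmulE ffunE => ->.
move: sP sQ dq; clear; lia.
Qed.

(** Homogeneity spreads the zeros from the chart to everything off the hyperplane. A transversal
    line through a point of the hyperplane then carries [q - 1] zeros, more than the degree [d]
    allows. *)
Lemma homog_dehomog_inj n d (f : fn n) (a : 'cV[F]_n) : a != 0 -> (d.+1 < q)%N ->
  isform true d f -> (forall v, (v *m a) 0 0 = 1 -> f v = 0) -> f = 0.
Proof.
move=> a0 dq hf h1.
have h2 v : (v *m a) 0 0 != 0 -> f v = 0.
  move=> va; rewrite -[v](scalerKV va) (isform_homog _ _ hf) h1 ?mulr0 //.
  by rewrite -scalemxAl mxE mulVf.
apply/ffunP => v; rewrite [RHS]ffunE.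
have [va|/h2 //] := eqVneq ((v *m a) 0 0) 0.
have [w wa] := direction_exists a0.
have [P sP hP] := isform_line v w hf.
have -> : f v = P.[0] by rewrite -hP scale0r addr0.
suff -> : P = 0 by rewrite horner0.
apply/eqP; apply: contraT => P0.
have := @max_poly_roots _ P (enum [set t : F | t != 0]) P0 _ (enum_uniq _).
rewrite -cardE card_nonzero => H.
have : (q - 1 < size P)%N.
  apply: H; apply/allP => t; rewrite mem_enum inE => t0; rewrite /root -hP h2 //.
  by rewrite mulmxDl -scalemxAl mxE va add0r mxE wa mulr1.
move: sP dq; clear; lia.
Qed.

Lemma dim_dehomog k d (W : {vspace fn k.+1}) (a : 'cV[F]_k.+1) e B :
    a != 0 -> (d.+1 < q)%N -> hyperplane_frame a (-1) e B -> forms true d W ->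
  \dim (pbL e B @: W)%VS = \dim W.
Proof.
move=> a0 dq [_ hv] hW; apply: limg_dim_eq; apply/eqP; rewrite -subv0.
apply/subvP => f; rewrite memv_cap memv_ker lfunE /= => /andP[fW /eqP f0].
rewrite memv0; apply/eqP; apply: (homog_dehomog_inj a0 dq (hW _ fW)) => v va.
have /hv [x ->] : aff a (-1) v = 0 by rewrite /aff va subrr.
by move/ffunP/(_ x): f0; rewrite !ffunE.
Qed.

Lemma card_cone_off n (Z : {set 'rV[F]_n}) (a : 'cV[F]_n) : cone Z ->
  (#|[set v in Z | (v *m a) 0 0 != 0]%R| <= (q - 1) * #|[set v in Z | aff a (-1) v == 0]%R|)%N.
Proof.
move=> hZ; set A := [set v in Z | _]; set A1 := [set v in Z | _].
rewrite -card_nonzero -cardsX.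
pose f (v : 'rV[F]_n) := ((v *m a) 0 0, ((v *m a) 0 0)^-1 *: v).
rewrite -(@card_in_imset _ _ f A).
  apply: subset_leq_card; apply/subsetP => _ /imsetP [v /setIdP [vZ va] ->].
  rewrite in_setX !inE /= va hZ //= /aff -scalemxAl mxE mulVf //.
  by rewrite subrr eqxx.
move=> v w /setIdP [_ va] /setIdP [_ wa] [E1].
by rewrite E1 => /(scalerI (invr_neq0 wa)).
Qed.

(** Off the hyperplane each vector is a nonzero multiple of one point of the chart where the form is
    1, and there the affine bound applies without loss of dimension. *)
Lemma card_zset_off k d (W : {vspace fn k.+2}) (a : 'cV[F]_k.+2) :
    a != 0 -> (d.+1 < q)%N -> forms true d W -> (0 < \dim W)%N ->
  (#|[set v in zset W | (v *m a) 0 0 != 0]%R|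
     <= (q - 1) * ((d - 1) * q ^ k + codim_card q k.+1 (\dim W)))%N.
Proof.
move=> a0 dq hW dW; apply: (leq_trans (card_cone_off a (cone_zset hW))).
have [e [B [hf _]]] := frame_exists (-1) a0.
rewrite leq_mul2l (card_zset_hyperplane W hf) -(dim_dehomog a0 dq hf hW).
apply/orP; right; apply: card_zset_affine; first exact: ltnW.
  by move=> f /memv_imgP [g gW ->]; rewrite lfunE /=; apply: isform_pb_affine (hW _ gW).
by rewrite (dim_dehomog a0 dq hf hW).
Qed.

(** The form [a] equals 1 on the chart, so the constant term of [u] becomes a multiple of [a];
    [pinvmx B] extends the linear part to the whole space. *)
Lemma isform_homogenize k (a : 'cV[F]_k.+1) e B (u : fn k) :
    hyperplane_frame a (-1) e B -> isform false 1 u ->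
  exists2 l : fn k.+1, isform true 1 l & pb e B l = u.
Proof.
case=> fB hv /isform1_affn [b [c [_ ->]]].
pose a' := pinvmx B *m b.
exists (affn ((c - (e *m a') 0 0) *: a + a') 0); first exact: isform_affn.
apply/ffunP => x; rewrite ffunE !affnE.
have : aff a (-1) (e + x *m B) = 0 by apply/hv; exists x.
rewrite /aff addr0 => /eqP; rewrite subr_eq0 => /eqP Ea.
have entryD (A C : 'M[F]_1) : (A + C) 0 0 = A 0 0 + C 0 0 by rewrite mxE.
have entryZ r (A : 'M[F]_1) : (r *: A) 0 0 = r * A 0 0 by rewrite mxE.
rewrite mulmxDr -scalemxAr entryD entryZ Ea mulr1 [(e + _) *m a']mulmxDl entryD.
by rewrite -(mulmxA x) /a' (mulmxA B) mulmxVp // mul1mx addrA subrK addrC.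
Qed.

Lemma card_hyperplane k (a : 'cV[F]_k.+1) c : a != 0 ->
  #|[set v | aff a c v == 0%R]| = (q ^ k)%N.
Proof.
move=> a0; have [e [B [hf _]]] := frame_exists c a0.
have zset0 n : zset (0%VS : {vspace fn n}) = setT.
  by apply/setP => v; rewrite in_setT; apply/zsetP => f; rewrite memv0 => /eqP ->; rewrite ffunE.
have := card_zset_hyperplane 0%VS hf; rewrite limg0 !zset0 cardsT card_rV => <-.
by apply: eq_card => v; rewrite !inE.
Qed.

(** Double counting of incident pairs: the origin lies on every hyperplane, any other vector on
    those whose normals lie in its dual hyperplane. Each hyperplane is counted once for each of its
    [q - 1] normals. *)
Lemma sum_hyperplane_sections k (Z : {set 'rV[F]_k.+1}) : 0 \in Z ->
  (\sum_(a : 'cV[F]_k.+1 | a != 0%R) #|[set v in Z | aff a 0 v == 0]%R|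
    = (q ^ k.+1 - 1) + (#|Z| - 1) * (q ^ k - 1))%N.
Proof.
move=> Z0.
transitivity (\sum_(v in Z) #|[set a : 'cV[F]_k.+1 | (a != 0) && (aff a 0 v == 0)]%R|)%N.
  transitivity (\sum_(a : 'cV[F]_k.+1 | a != 0%R) \sum_(v in Z | aff a 0%R v == 0%R) 1)%N.
    apply: eq_bigr => a _; rewrite -sum1_card; apply: eq_bigl => v.
    exact: in_set.
  rewrite (exchange_big_dep (mem Z)) /=; last by move=> a v _ /andP[].
  apply: eq_bigr => v vZ; rewrite -sum1_card; apply: eq_bigl => a.
  by rewrite in_set vZ.
have card_cV : #|'cV[F]_k.+1| = (q ^ k.+1)%N by rewrite card_mx muln1.
rewrite (bigD1 0) //=; congr (_ + _)%N.
  rewrite (_ : [set _ | _] = [set~ 0]) ?cardsC1 ?card_cV ?subn1 //.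
  by apply/setP => a; rewrite !inE /aff mul0mx mxE addr0 eqxx andbT.
rewrite (cardsD1 0) Z0 add1n subn1 /= -sum_nat_const.
apply: eq_big => [v|v /andP[vZ v0]]; first by rewrite !inE andbC.
have vt0 : v^T != 0 by apply: contraNneq v0 => vt; rewrite -[v]trmxK vt trmx0.
rewrite -(card_hyperplane 0 vt0).
pose H : {set 'rV[F]_k.+1} := [set w | aff v^T 0 w == 0].
have H0 : 0 \in H by rewrite inE /aff mul0mx mxE addr0.
rewrite -/H (cardsD1 0 H) H0 add1n subn1 /= -(card_imset (mem (H :\ 0)) (@trmx_inj _ _ _)).
apply: eq_card => w; rewrite in_set; apply/andP/imsetP.
  case=> w0 wv; exists w^T; last by rewrite trmxK.
  rewrite !inE; apply/andP; split.
    by apply: contraNneq w0 => bt; rewrite -[w]trmxK bt trmx0.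
  by rewrite /aff addr0 -trmx_mul mxE -[X in X == 0]addr0.
case=> b /setD1P [b0]; rewrite in_set /aff !addr0 => vb ->; split.
  by apply: contraNneq b0 => bt; rewrite -[b]trmxK bt trmx0.
by rewrite -[v]trmxK -trmx_mul mxE.
Qed.

End Cones.

(** * The projective bound *)

(* [1 + (q - 1) N], where [N] bounds the number of points in projective
   dimension [k + 1]: the count in the cone, origin included. *)
Definition cone_bound q k d r :=
  (q ^ k * (1 + (q - 1) * (d - 1)) + (q - 1) * codim_card q k.+1 r)%N.

Lemma leq_cone_boundS q k d r : (q * cone_bound q k d r <= cone_bound q k.+1 d r)%N.
Proof.
rewrite /cone_bound mulnDr mulnA -expnS leq_add2l mulnCA leq_mul2l.
by rewrite leq_codim_cardS orbT.
Qed.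

(** An equality: a full hyperplane together with the affine bound for the quotients meets the cone
    bound exactly. The extremal systems are of this kind. *)
Lemma cone_bound_divisible q x t C : (0 < q)%N ->
  (q * t + (q - 1) * (x * t + C) = t * (1 + (q - 1) * x.+1) + (q - 1) * C)%N.
Proof. by case: q => // q _; rewrite subn1 /=; ring. Qed.

(** Once [(q - 1) * (x * (q * t))] cancels, [q * q * t] on the right faces at most
    [t + (q - 1) * (x + 3) * t] on the left, and [x + 3 <= q]. *)
Lemma cone_bound_two q x t A B C : (x.+2 < q)%N -> (A <= t)%N -> (B <= t)%N ->
  (t * (1 + (q - 1) * x.+1) + (q - 1) * A + (q - 1) * (x * (q * t) + B)
   <= q * t * (1 + (q - 1) * x.+1) + (q - 1) * C)%N.
Proof.
move=> xq At Bt.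
have [y Ey] : exists y, q = (x + 3 + y)%N by exists (q - x - 3)%N; lia.
have h1 : ((q - 1) * A <= (q - 1) * t)%N by rewrite leq_mul2l At orbT.
have h2 : ((q - 1) * B <= (q - 1) * t)%N by rewrite leq_mul2l Bt orbT.
rewrite (leq_trans _ (leq_addr _ _)) // [((q - 1) * (_ + B))%N]mulnDr.
apply: (@leq_trans (t * (1 + (q - 1) * x.+1) + (q - 1) * t +
                    ((q - 1) * (x * (q * t)) + (q - 1) * t))%N).
  by rewrite leq_add ?leq_add2l.
subst q; clear.
have -> : (x + 3 + y - 1 = x + 2 + y)%N by lia.
nia.
Qed.

(** The same [C] stands on both sides: the section loses one dimension of forms along with one
    dimension of space, which leaves the codimension term unchanged. *)
Lemma cone_bound_one q x t C : (0 < q)%N ->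
  (t * (1 + (q - 1) * x) + (q - 1) * C + (q - 1) * (x * (q - 1) * t)
   <= q * t * (1 + (q - 1) * x) + (q - 1) * C)%N.
Proof.
case: q => // q _; rewrite subn1 /=; nia.
Qed.

(* The bounds are tight up to an error below 2, so the averaging step needs the
   integrality of the number [Y] of projective points. *)
Lemma averaging_arith q T A E Y : (1 < q)%N ->
    ((q - 1) * A + E < 2 * (T - 1))%N ->
    ((q * T - 1) + (q - 1) * Y * (T - 1)
       <= (q * T - 1) * (1 + (q - 1) * A) + (q - 1) * E)%N ->
  (1 + (q - 1) * Y <= q * (1 + (q - 1) * A))%N.
Proof.
case: q => [//|[//|q]] _; have -> : (q.+2 - 1 = q.+1)%N by lia.
case: T => [|T]; first by rewrite muln0.
have -> : (T.+1 - 1 = T)%N by lia.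
have -> : (q.+2 * T.+1 - 1 = q.+2 * T + q.+1)%N by rewrite mulnS; lia.
move=> hE h.
have {}h : (Y * T <= (q.+2 * T + q.+1) * A + E)%N.
  rewrite -(leq_pmul2l (ltn0Sn q)); move: h; move: (_ + q.+1)%N => c.
  rewrite [(c * (1 + _))%N]mulnDr muln1 -addnA leq_add2l -mulnA => /leq_trans; apply.
  by rewrite mulnDr leq_add2r mulnCA.
suff : (Y <= q.+2 * A + 1)%N.
  by move=> hY; have : (q.+1 * Y <= q.+1 * (q.+2 * A + 1))%N; [rewrite leq_mul2l hY orbT|]; lia.
rewrite leqNgt; apply/negP => hY.
have : ((q.+2 * A + 2) * T <= Y * T)%N by rewrite leq_mul2r addn2 -[_.+2]/((_.+1).+1) -addn1 hY orbT.
rewrite mulnDl => h'; have := leq_trans h' h.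
rewrite [X in (_ <= X + _)%N]mulnDl mulnAC -addnA leq_add2l; lia.
Qed.

(** Supplies the error hypothesis of [averaging_arith]: for a space of dimension [r.+1], at most
    [q ^ r.+1 - 1] normals are degenerate, and up to a factor [q - 1] each adds the difference of
    the two codimension terms. This difference is [(q - 1) * q ^ (k - r)] for [r <= k], 1 for
    [r = k + 1] and 0 beyond, so the total stays below [q ^ k.+2]. *)
Lemma averaging_gain q k d r A : (1 < d)%N -> (d.+1 < q)%N ->
    cone_bound q k d r.+1 = (1 + (q - 1) * A)%N ->
  ((q - 1) * A + (q ^ r.+1 - 1) * (codim_card q k.+1 r - codim_card q k.+1 r.+1)
    < 2 * (q ^ k.+2 - 1))%N.
Proof.
rewrite /cone_bound codim_cardSS; move=> d1 dq E.
have t0 : (0 < q ^ k)%N by rewrite expn_gt0; lia.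
have hd : ((q - 1) * (d - 1) + 2 * q <= q * q)%N.
  have [y Ey] : exists y, d = y.+2 by exists (d - 2)%N; lia.
  have [z Ez] : exists z, q = (y + 4 + z)%N by exists (q - y - 4)%N; lia.
  rewrite Ey Ez (_ : y + 4 + z - 1 = y + 3 + z)%N; last by lia.
  by rewrite subSS subn0; nia.
have {}hd : (q ^ k * (1 + (q - 1) * (d - 1)) + q * q ^ k < q * q * q ^ k)%N.
  rewrite [(q * q ^ k)%N]mulnC -mulnDr [X in (_ < X)%N]mulnC ltn_pmul2l //; lia.
rewrite !expnS; move: E hd t0; set N := (q ^ k * (1 + _))%N; set t := (q ^ k)%N => E hd t0.
have [rk|kr] := leqP r k.
  have := codim_cardSS q k r; rewrite {1 2}/codim_card ltnS rk subSS => _.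
  have -> : codim_card q k.+1 r = (q * q ^ (k - r))%N.
    by rewrite /codim_card leqW // subSn // expnS.
  move: E; rewrite /codim_card rk; set x := (q ^ (k - r))%N => E.
  have xt : (q ^ r * x = t)%N by rewrite -expnD subnKC.
  have -> : ((q * q ^ r - 1) * (q * x - x) = (q - 1) * (q * t) - (q - 1) * x)%N.
    have -> : (q * x - x = (q - 1) * x)%N by rewrite mulnBl mul1n.
    by rewrite mulnCA [((_ - 1) * x)%N]mulnBl mul1n -mulnA xt mulnBr.
  have : ((q - 1) * x <= (q - 1) * (q * t))%N.
    rewrite leq_mul2l; apply/orP; right; rewrite -xt mulnA leq_pmull //.
    by rewrite muln_gt0 expn_gt0; lia.
  have : ((q - 1) * (q * t) + q * t = q * q * t)%N by rewrite mulnBl mul1n mulnA subnK // -mulnA leq_pmull //; lia.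
  move: E; rewrite -mulnA; lia.
move: E; rewrite {1 3}/codim_card leqNgt kr /= muln0 addn0 subn0 => E.
have := codim_cardSS q k r.
rewrite /codim_card; case: (leqP r k.+1) => [rk|_ _]; last first.
  by rewrite muln0 addn0; move: E hd; rewrite -mulnA; lia.
have -> : r = k.+1 by lia.
rewrite subnn expn0 muln1 expnS -/t; move: E hd; rewrite -mulnA; lia.
Qed.

Section UpperBound.
Variable F : finFieldType.
Local Notation q := #|F|.
Local Notation fn n := {ffun 'rV[F]_n -> F^o}.
Local Notation q_gt0 := (card_field_gt0 F).
Local Notation q_gt1 := (finNzRing_gt1 F).

Lemma fun_neq0 n (f : fn n) v : f v != 0 -> f != 0.
Proof. by apply: contraNneq => ->; rewrite ffunE. Qed.

Lemma affn_neq0 n (a : 'cV[F]_n) : a != 0 -> affn a 0 != 0.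
Proof.
move=> /direction_exists [w wa]; apply: (@fun_neq0 _ _ w).
by rewrite affnE /aff wa addr0 oner_eq0.
Qed.

Lemma pb_fmul N n e (B : 'M[F]_(n, N)) (f g : fn N) :
  pb e B (fmul f g) = fmul (pb e B f) (pb e B g).
Proof. by apply/ffunP => x; rewrite !ffunE. Qed.

(** The form [affn a 0] behaves as a prime: it does not divide [g], which is nonzero on the
    hyperplane, so it divides [u], of degree 1. In place of an integral domain stands [fmul_neq0],
    which holds for functions of low degree. *)
Lemma linear_factor_unique k d (a : 'cV[F]_k.+1) (B : 'M[F]_(k, k.+1)) (g u w : fn k.+1) :
    a != 0 -> hyperplane_frame a 0 0 B -> (d.+1 < q)%N ->
    isform true d g -> isform true d w -> isform true 1 u -> pb 0 B g != 0 ->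
    fmul (affn a 0) w = fmul g u ->
  exists c, u = c *: affn a 0 /\ w = c *: g.
Proof.
move=> a0 [_ hv] dq hg hw hu g0 E.
have u0 : pb 0 B u = 0.
  apply/eqP; apply: contraT => u0.
  have : fmul (pb 0 B g) (pb 0 B u) != 0.
    apply: fmul_neq0 (isform_pb _ _ hg) (isform_pb _ _ hu) _ g0 u0 => //.
    by rewrite addn1.
  rewrite -pb_fmul -E => /eqP []; apply/ffunP => x; rewrite !ffunE /=.
  have -> : aff a 0 (0 + x *m B) = 0 by apply/hv; exists x.
  by rewrite mul0r.
have [e ea] := direction_exists a0.
have [b hb bE] := isform_division a e (fun _ : true => erefl (0 : F)) hu.
have [c cE] := isform0_const hb.
have uE : u = c *: affn a 0.
  apply/ffunP => v; have := bE v.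
  have /hv [x ->] : aff a 0 (v - aff a 0 v *: e) = 0.
    by rewrite -scaleNr aff_lin ea mulr1 subrr.
  have -> : u (0 + x *m B) = 0 by move/ffunP/(_ x): u0; rewrite !ffunE.
  by rewrite subr0 cE !ffunE => ->; exact: mulrC.
exists c; split=> //; apply/eqP; rewrite -subr_eq0; apply: contraT => wg.
have ha : isform true 1 (affn a 0) by apply: isform_affn.
have hwg : isform true d (w - c *: g) by apply: isformB => //; apply: isformZ.
have := fmul_neq0 ha hwg; rewrite add1n => /(_ dq (affn_neq0 a0) wg) /eqP [].
apply/ffunP => v; move/ffunP/(_ v): E; rewrite uE !ffunE => E.
rewrite mulrDr E /GRing.scale /=; ring.
Qed.

(** Since [W] does not vanish on the hyperplane, neither does [g]. An element of [W = g U] vanishing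
    there is thus [g] times a multiple of [affn a 0], so the kernel of the restriction is a line. *)
Lemma degenerate_hyperplane k d (W U : {vspace fn k.+1}) (g : fn k.+1) a B :
    a != 0 -> hyperplane_frame a 0 0 B -> (d.+1 < q)%N ->
    isform true d g -> forms true 1 U -> forms true d.+1 W -> (mulL g @: U)%VS = W ->
    (0 < \dim (pbL 0 B @: W)%VS)%N -> (\dim (pbL 0 B @: W)%VS < \dim W)%N ->
  affn a 0 \in U /\ (\dim (pbL 0 B @: W)%VS).+1 = \dim W.
Proof.
move=> a0 hf dq hg hU hW gU d0 dlt.
have g0 : pb 0 B g != 0.
  apply/eqP => g0; move: d0; rewrite dim_zero_fun // => f /memv_imgP [f' + ->].
  rewrite -gU => /memv_imgP [u uU ->]; rewrite !lfunE /= pb_fmul g0.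
  by apply/ffunP => x; rewrite !ffunE mul0r.
have [//|W' [hW' dE uW]] := restrict_space a0 _ hf hW.
have key w : w \in W' -> exists u c, [/\ u \in U, u = c *: affn a 0 & w = c *: g].
  move=> wW'; have := uW _ wW'; rewrite -gU => /memv_imgP [u uU]; rewrite lfunE /= => E.
  have [c [Eu Ew]] := linear_factor_unique a0 hf dq hg (hW' _ wW') (hU _ uU) g0 E.
  by exists u, c.
have dW'0 : (0 < \dim W')%N by move: dlt dE; clear; lia.
split.
  have [w wW' w0] := dim_gt0_exists dW'0.
  have [u [c [uU Eu Ew]]] := key _ wW'.
  have c0 : c != 0 by apply: contraNneq w0 => c0; rewrite Ew c0 scale0r.
  by rewrite -(scalerK c0 (affn a 0)) -Eu; apply: memvZ.
have : (\dim W' <= \dim <[g]>)%N.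
  apply: dimvS; apply/subvP => w /key [_ [c [_ _ ->]]].
  by apply: memvZ; exact: memv_line.
rewrite dim_vline; move: dW'0 dE; case: (g != 0); clear; lia.
Qed.

Lemma card_linear_forms k (U : {vspace fn k}) :
  (#|[set a : 'cV[F]_k | (a != 0) && (affn a 0 \in U)]%R| <= q ^ \dim U - 1)%N.
Proof.
set S := [set a | _].
have S0 : 0 \notin S by rewrite inE eqxx.
rewrite -(leq_add2l 1) -[X in (X + _ <= _)%N]/(nat_of_bool true) -{1}S0 -cardsU1.
rewrite subnKC ?expn_gt0 ?q_gt0 //.
pose f (a : 'cV[F]_k) := [ffun i : 'I_(\dim U) => coord (vbasis U) i (affn a 0)].
rewrite -[X in (_ <= _ ^ X)%N]card_ord -card_ffun.
rewrite -(@card_in_imset _ _ f); first exact: max_card.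
have inU a : a \in 0 |: S -> affn a 0 \in U.
  rewrite !inE => /orP[/eqP -> |/andP[_ //]].
  rewrite (_ : affn 0 0 = 0) ?mem0v //.
  by apply/ffunP => v; rewrite !ffunE /aff mulmx0 mxE addr0.
move=> a b /inU aU /inU bU /ffunP E.
have Eab : affn a 0 = affn b 0.
  rewrite (coord_vbasis aU) (coord_vbasis bU); apply: eq_bigr => i _.
  by have := E i; rewrite !ffunE => ->.
apply/colP => i; move/ffunP/(_ (delta_mx 0 i)): Eab; rewrite !affnE /aff !addr0.
by rewrite -!rowE !mxE.
Qed.

(** Base case, the projective line: the line through a vector [v] with [f v != 0] meets the cone
    only in the origin, and its complement is handled by the affine chart. *)
Lemma card_zset_plane d (W : {vspace fn 2}) : (d.+2 < q)%N -> forms true d.+1 W ->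
  (0 < \dim W)%N -> (#|zset W| <= cone_bound q 0 d.+1 (\dim W))%N.
Proof.
move=> dq hW dW; have [f fW f0] := dim_gt0_exists dW.
have [v fv] : exists v, f v != 0.
  apply/existsP; apply: contraNT f0; rewrite negb_exists => /forallP h.
  by apply/eqP/ffunP => v; rewrite ffunE; apply/eqP; have := h v; rewrite negbK.
have v0 : v != 0.
  apply: contraNneq fv => ->; rewrite -(scale0r (0 : 'rV[F]_2)).
  by rewrite (isform_homog _ _ (hW _ fW)) exprS !mul0r.
pose a : 'cV[F]_2 := \col_i (if i == 0 then v 0 1 else - v 0 0).
have va : aff a 0 v = 0.
  by rewrite /aff addr0 mxE big_ord_recl big_ord1 !mxE /= mulrN (_ : lift _ _ = 1) ?[v 0 1 * _]mulrC ?subrr //; exact: val_inj.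
have a0 : a != 0.
  apply: contraNneq v0 => /colP a0; apply/eqP/rowP => i; rewrite mxE.
  have := a0 0; have := a0 1; rewrite !mxE /= => /eqP; rewrite oppr_eq0 => /eqP h0 h1.
  by case: i => -[|[|//]] hi; [rewrite -[RHS]h0|rewrite -[RHS]h1]; congr (v _ _); apply: val_inj.
have [e [B [hf e0]]] := frame_exists 0 a0; rewrite {e}e0 // in hf.
apply: (leq_trans (card_zset_restrict (Z := [set v in zset W | (v *m a) 0 0 != 0]) hf _)).
  by move=> w wW; rewrite /aff addr0 inE => ->; rewrite wW.
have h1 : (#|zset (pbL 0 B @: W)%VS| <= 1)%N.
  apply: (@leq_trans #|[set 0 : 'rV[F]_1]|); last by rewrite cards1.
  apply: subset_leq_card; apply/subsetP => y.
  rewrite zset_pbL in_set1 add0r => yW; apply: contraNT fv => y0.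
  have [_ /(_ v) [/(_ va) [x Ex] _]] := hf.
  have y00 : y 0 0 != 0.
    by apply: contraNneq y0 => y00; apply/eqP/rowP => i; rewrite !ord1 y00 mxE.
  have -> : v = (x 0 0 / y 0 0) *: (y *m B).
    rewrite Ex add0r scalemxAl; congr (_ *m B); apply/rowP => i.
    by rewrite !ord1 mxE divfK.
  by have /zsetP/(_ _ fW) -> := cone_zset hW (x 0 0 / y 0 0) yW.
apply: (leq_trans (leq_add h1 (card_zset_off a0 dq hW dW))).
by rewrite /cone_bound expn0 mul1n muln1 mulnDr addnA.
Qed.

Theorem card_zset_cone k d (W : {vspace fn k.+2}) : (1 < d)%N -> (d.+1 < q)%N ->
  forms true d W -> (0 < \dim W)%N -> (#|zset W| <= cone_bound q k d (\dim W))%N.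
Proof.
elim: k W => [|k IH] W.
  by case: d => // d _ dq hW dW; exact: card_zset_plane.
case: d IH => [//|[//|d]] IH d1 dq hW dW; have {}IH W' := IH W' d1 dq.
have /fin_all_exists [B_ hB] (a : 'cV[F]_k.+3) :
    exists B : 'M[F]_(k.+2, k.+3), a != 0 -> hyperplane_frame a 0 0 B.
  have [a0|a0] := eqVneq a 0; first by exists 0.
  have [e [B [hf e0]]] := frame_exists 0 a0; rewrite {e}e0 // in hf.
  by exists B.
pose Wr a := (pbL 0 (B_ a) @: W)%VS.
have hWr a : forms true d.+2 (Wr a) by apply: forms_pbL.
have off_sub (a : 'cV[F]_k.+3) (W' : {vspace fn k.+3}) :
    (forall u, u \in W' -> fmul (affn a 0) u \in W) ->
    {in zset W, forall v, aff a 0 v != 0 -> v \in [set v in zset W' | (v *m a) 0 0 != 0]}.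
  move=> uW v vW av; rewrite inE (quotient_space_subset uW vW av) /=.
  by move: av; rewrite /aff addr0.
case: (boolP [exists a, (a != 0) && (\dim (Wr a) == 0%N)]).
  case/existsP => a /andP[a0 /eqP t0].
  have [//|W' [hW' dE uW]] := restrict_space a0 _ (hB a a0) hW.
  rewrite -/(Wr a) t0 addn0 in dE.
  apply: (leq_trans (card_zset_restrict (hB a a0) (off_sub _ _ uW))).
  have dW' : (0 < \dim W')%N by rewrite dE.
  have h2 := card_zset_off a0 (ltnW dq) hW' dW'.
  have h1 : (#|zset (Wr a)| <= q ^ k.+2)%N by rewrite -card_rV max_card.
  apply: (leq_trans (leq_add h1 h2)).
  rewrite dE /cone_bound !subSS !subn0 (expnS _ k.+1) cone_bound_divisible ?q_gt0 //.
rewrite negb_exists => /forallP tpos.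
have {}tpos a : a != 0 -> (0 < \dim (Wr a))%N.
  by move=> a0; have := tpos a; rewrite a0 /= lt0n.
(* The averaging argument. [S] contains all normals of degenerate hyperplanes, and each of these
   loses a single dimension, so its section bound rises by the same [(q - 1) * gap]. *)
have goal_of_sections (S : {set 'cV[F]_k.+3}) :
    (#|S| <= q ^ \dim W - 1)%N ->
    (forall a, a != 0 -> a \notin S -> \dim (Wr a) = \dim W) ->
    (forall a, a != 0 -> (\dim (Wr a)).+1 = \dim W \/ \dim (Wr a) = \dim W) ->
  (#|zset W| <= cone_bound q k.+1 d.+2 (\dim W))%N.
  move=> cS gd bd.
  apply: leq_trans (leq_cone_boundS _ _ _ _).
  case dE: (\dim W) (dW) => [//|r] _; rewrite dE in cS gd bd.
  set b := cone_bound q k d.+2 r.+1.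
  pose gap := (codim_card q k.+1 r - codim_card q k.+1 r.+1)%N.
  have bE : cone_bound q k d.+2 r = (b + (q - 1) * gap)%N.
    rewrite /b /cone_bound -addnA -mulnDr /gap subnKC //.
    exact: leq_codim_card q_gt0 (leqnSn r).
  have sec a : a != 0 -> (#|[set v in zset W | aff a 0 v == 0]%R|
                           <= b + (if a \in S then (q - 1) * gap else 0))%N.
    move=> a0; rewrite (card_zset_hyperplane W (hB a a0)) -/(Wr a).
    apply: (leq_trans (IH _ (hWr a) (tpos a a0))).
    case: ifP => [aS|/negbT aS]; last by rewrite gd // addn0.
    case: (bd a a0) => [[->]|->]; first by rewrite bE.
    exact: leq_addr.
  have Z0 := zset_at0 hW.
  have := sum_hyperplane_sections Z0.
  set Y := #|[set P in proj_space F k.+2 | P \subset zset W]|.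
  have ZE : #|zset W| = (1 + (q - 1) * Y)%N.
    by rewrite (cardsD1 0) Z0 (card_cone (cone_zset hW)) mulnC.
  rewrite ZE addKn => sumE.
  (* The geometric sum shows that the cone bound is 1 modulo [q - 1], so [A] is an integral number
     of projective points. *)
  have [p pE] : exists p, (q ^ k = 1 + (q - 1) * p)%N.
    exists (\sum_(i < k) q ^ i)%N; rewrite subn1 -predn_exp add1n prednK //.
    by rewrite expn_gt0 q_gt0.
  pose A := (p + q ^ k * d.+1 + codim_card q k.+1 r.+1)%N.
  have AE : b = (1 + (q - 1) * A)%N.
    rewrite /b /cone_bound /A !mulnDr muln1 addnA {1}pE -!addnA; congr (1 + (_ + (_ + _)))%N.
    by rewrite mulnCA subSS subn0.
  rewrite AE; apply: (averaging_arith q_gt1 (averaging_gain d1 dq AE)).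
  rewrite -expnS -sumE -AE -/gap.
  apply: (@leq_trans (\sum_(a : 'cV[F]_k.+3 | a != 0%R)
             (b + (if a \in S then (q - 1) * gap else 0)))%N).
    exact: leq_sum.
  rewrite big_split /= sum_nat_const leq_add //.
    rewrite leq_mul2r (eq_card (B := predC1 0)) // cardC1 card_mx muln1 subn1 leqnn.
    by rewrite orbT.
  rewrite -big_mkcondr /= sum_nat_const mulnCA leq_mul2l leq_mul2r.
  rewrite (leq_trans _ cS) ?orbT //.
  by apply: subset_leq_card; apply/subsetP => a /andP[].
case: (boolP [exists a, (a != 0) && (\dim (Wr a) < \dim W)%N]); last first.
  rewrite negb_exists => /forallP h.
  have dE a : a != 0 -> \dim (Wr a) = \dim W.
    move=> a0; apply/eqP; rewrite eqn_leq dim_limg_leq leqNgt.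
    by have := h a; rewrite a0.
  apply: (goal_of_sections set0); first by rewrite cards0.
    by move=> a a0 _; exact: dE.
  by move=> a a0; right; exact: dE.
case/existsP => a /andP[a0 dlt].
have [//|W' [hW' dE uW]] := restrict_space a0 _ (hB a a0) hW.
rewrite -/(Wr a) in dE.
have b1 := IH _ (hWr a) (tpos a a0).
have dW' : (0 < \dim W')%N by move: dE dlt; clear; lia.
have [s2|s1] : (1 < \dim W')%N \/ \dim W' = 1%N by move: dW'; clear; lia.
  apply: (leq_trans (card_zset_restrict (hB a a0) (off_sub _ _ uW))).
  have b2 := card_zset_off a0 (ltnW dq) hW' dW'.
  have c1 := leq_codim_card k.+1 q_gt0 (tpos a a0).
  have c2 := leq_codim_card k.+2 q_gt0 s2.
  rewrite codim_cardSS codim_card0 in c1; rewrite !codim_cardSS codim_card0 in c2.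
  apply: (leq_trans (leq_add b1 b2)).
  rewrite /cone_bound !subSS !subn0 expnS; exact: cone_bound_two (ltnW dq) c1 c2.
have [g gW' g0] := dim_gt0_exists dW'.
have [e [A [hA _]]] := frame_exists (-1) a0.
pose Z := [set v in zset W | g v == 0].
have hZ : cone Z.
  move=> c v /setIdP [vW /eqP gv]; rewrite inE (cone_zset hW c vW).
  by rewrite (isform_homog _ _ (hW' _ gW')) gv mulr0 eqxx.
have tE : \dim W = (\dim (Wr a)).+1 by move: dE s1; clear; lia.
have [Zle|Zgt] := leqP #|[set v in Z | aff a (-1) v == 0]%R| (d.+1 * (q - 1) * q ^ k).
  have sub : {in zset W, forall v, aff a 0 v != 0 -> v \in [set v in Z | (v *m a) 0 0 != 0]}.
    move=> v vW av; rewrite inE; apply/andP; split; last by move: av; rewrite /aff addr0.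
    by rewrite inE vW (quotient_subset (uW _ gW') vW av) eqxx.
  apply: (leq_trans (card_zset_restrict (hB a a0) sub)).
  have b2 := leq_trans (card_cone_off a hZ) (leq_mul (leqnn (q - 1)) Zle).
  apply: (leq_trans (leq_add b1 b2)).
  rewrite tE /cone_bound !codim_cardSS !subSS !subn0 expnS.
  exact: cone_bound_one q_gt0.
(* In the chart, so many common zeros with [g] force every [f] in [W] to be [g] times an affine
   cofactor. The cofactor is homogenized, and the identity lifts because a form of degree below
   [q - 1] is determined by its values on the chart. *)
have [U [hU gU dU]] : exists U : {vspace fn k.+3},
    [/\ forms true 1 U, (mulL g @: U)%VS = W & \dim U = \dim W].
  apply: factor_common => f fW.
  have hgA : isform false d.+1 (pb e A g) := isform_pb_affine _ _ (hW' _ gW').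
  have hfA : isform false d.+2 (pb e A f) := isform_pb_affine _ _ (hW _ fW).
  have gA0 : pb e A g != 0.
    apply: contraNneq g0 => gA; apply/eqP.
    apply: (homog_dehomog_inj a0 (ltnW dq) (hW' _ gW')) => v va.
    have /(proj2 hA) [x ->] : aff a (-1) v = 0 by rewrite /aff va subrr.
    by move/ffunP/(_ x): gA; rewrite !ffunE.
  have [hle|[u hu Eu]] := card_common_zeros_form hgA hfA gA0 (ltnW dq).
    move: Zgt; rewrite ltnNge (leq_trans _ hle) //.
    rewrite -(card_imset _ (frame_inj hA)).
    apply: subset_leq_card; apply/subsetP => v /setIdP [/setIdP [/zsetP vW gv]].
    move=> /eqP /(proj2 hA) [x Ex]; apply/imsetP; exists x => //.
    by rewrite inE !ffunE -Ex gv vW ?eqxx.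
  have [l hl El] := isform_homogenize hA hu.
  exists l => //; apply/eqP; rewrite -subr_eq0; apply/eqP.
  apply: (homog_dehomog_inj a0 dq).
    apply: isformB (hW _ fW) _.
    by have := isform_fmul (hW' _ gW') hl; rewrite (addn1 d.+1).
  move=> v va; have /(proj2 hA) [x ->] : aff a (-1) v = 0 by rewrite /aff va subrr.
  move/ffunP/(_ x): Eu; rewrite -El -pb_fmul !ffunE => ->; exact: subrr.
apply: (goal_of_sections [set a : 'cV[F]_k.+3 | (a != 0) && (affn a 0 \in U)]).
- by rewrite -dU; exact: card_linear_forms.
- move=> b b0; rewrite inE b0 /= => bU; apply/eqP; rewrite eqn_leq dim_limg_leq leqNgt /=.
  apply: contra bU => blt.
  by case: (degenerate_hyperplane b0 (hB b b0) (ltnW dq) (hW' _ gW') hU hW gU (tpos b b0) blt).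
- move=> b b0; have := dim_limg_leq (pbL 0 (B_ b)) W.
  rewrite leq_eqVlt => /orP[/eqP ->|blt]; [by right|left].
  by case: (degenerate_hyperplane b0 (hB b b0) (ltnW dq) (hW' _ gW') hU hW gU (tpos b b0) blt).
Qed.

End UpperBound.

(** * Systems of homogeneous polynomials *)

Section Systems.
Variable F : finFieldType.
Local Notation q := #|F|.
Local Notation fn n := {ffun 'rV[F]_n -> F^o}.
Local Notation q_gt0 := (card_field_gt0 F).
Local Notation q_gt1 := (finNzRing_gt1 F).

Definition feval_dhomog m d (p : dhomog m.+1 F d) : fn m.+1 := feval p.

Lemma feval_dhomog_linear m d : linear (@feval_dhomog m d).
Proof.
by move=> k p r; apply/ffunP => v; rewrite !ffunE /mval mevalD mevalZ.
Qed.
HB.instance Definition _ m d :=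
  GRing.isLinear.Build F (dhomog m.+1 F d) (fn m.+1) _ (@feval_dhomog m d) (@feval_dhomog_linear m d).

Definition evalL m d : 'Hom(dhomog m.+1 F d, fn m.+1) :=
  linfun (@feval_dhomog m d).

Lemma evalLE m d (p : dhomog m.+1 F d) v : evalL m d p v = mval p v.
Proof. by rewrite lfunE /= ffunE. Qed.

Lemma feval_inj m d (p : dhomog m.+1 F d) : (d < q)%N -> evalL m d p = 0 -> p = 0.
Proof.
move=> dq p0; apply: val_inj => /=; apply/eqP; apply: contraT => pn0.
have sp : (msize (p : {mpoly F[m.+1]}) <= d.+1)%N.
  have /dhomogP hp := dhomog_is_dhomog p.
  by rewrite -mlead_deg // (hp _ (mlead_supp pn0)).
have := card_zeros_mpoly pn0 sp.
rewrite (_ : [set x | _] = setT); last first.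
  by apply/setP => v; rewrite !inE -evalLE p0 ffunE eqxx.
by rewrite cardsT card_rV leq_pmul2r ?expn_gt0 ?q_gt0 // leqNgt dq.
Qed.

Definition span_of m d r (f : r.-tuple (dhomog m.+1 F d)) : {vspace fn m.+1} :=
  (evalL m d @: <<f>>)%VS.

Lemma dim_span_of m d r (f : r.-tuple (dhomog m.+1 F d)) :
  (d < q)%N -> free f -> \dim (span_of f) = r.
Proof.
move=> dq; rewrite /free size_tuple => /eqP dr; rewrite -[RHS]dr; apply: limg_dim_eq.
apply/eqP; rewrite -subv0; apply/subvP => p.
by rewrite memv_cap memv_ker memv0 => /andP[_ /eqP /feval_inj ->].
Qed.

Lemma forms_span_of m d r (f : r.-tuple (dhomog m.+1 F d)) : forms true d (span_of f).
Proof.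
move=> _ /memv_imgP [p _ ->]; rewrite lfunE /=.
exact: isform_feval_homog (dhomog_is_dhomog p).
Qed.

Lemma zset_span_of m d r (f : r.-tuple (dhomog m.+1 F d)) v :
  (v \in zset (span_of f)) = [forall i : 'I_r, mval (tnth f i) v == 0].
Proof.
apply/zsetP/forallP => [h i|h _ /memv_imgP [p pf ->]].
  by rewrite -evalLE h // memv_img // memv_span // mem_tnth.
rewrite (coord_span pf) linear_sum sum_ffunE big1 // => i _.
rewrite linearZ ffunE /= evalLE -tnth_nth (eqP (h i)); exact: scaler0.
Qed.

Lemma common_zerosE m d r (f : r.-tuple (dhomog m.+1 F d)) :
  common_zeros f = [set P in proj_space F m | P \subset zset (span_of f)].
Proof.
apply/setP => P; rewrite !inE; congr (_ && _).
apply/forall_inP/subsetP => h v vP; first by rewrite zset_span_of; exact: h.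
by have := h v vP; rewrite zset_span_of.
Qed.

Lemma card_zset_span_of m d r (f : r.-tuple (dhomog m.+1 F d.+1)) :
  #|zset (span_of f)| = (1 + (q - 1) * #|common_zeros f|)%N.
Proof.
have hW := @forms_span_of m d.+1 r f.
by rewrite (cardsD1 0) (zset_at0 hW) (card_cone (cone_zset hW)) common_zerosE mulnC.
Qed.

(** * Extremal systems *)

Lemma card_row_box n (D : 'I_n -> {set F}) :
  #|[set v : 'rV[F]_n | [forall i, v 0 i \in D i]]| = (\prod_(i < n) #|D i|)%N.
Proof.
transitivity #|family (fun i => mem (D i))|; last first.
  by rewrite card_family foldrE big_map big_enum.
rewrite -(@card_imset _ _ (fun v : 'rV[F]_n => [ffun i => v 0 i])); last first.
  by move=> v w /ffunP E; apply/rowP => i; have := E i; rewrite !ffunE.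
apply: eq_card => e; apply/imsetP/familyP => [[v + ->] i|he].
  by rewrite inE => /forallP; rewrite ffunE.
exists (\row_i e i); last by apply/ffunP => i; rewrite ffunE mxE.
by rewrite inE; apply/forallP => i; rewrite mxE; exact: he.
Qed.

Lemma card_ends k (a b : F) :
  #|[set v : 'rV[F]_k.+2 | (v 0 ord0 == a) && (v 0 ord_max == b)]| = (q ^ k)%N.
Proof.
pose D (i : 'I_k.+2) : {set F} :=
  if i == 0 :> nat then [set a] else if i == k.+1 :> nat then [set b] else setT.
rewrite (_ : [set v | _] = [set v : 'rV[F]_k.+2 | [forall i, v 0 i \in D i]]).
  rewrite card_row_box big_ord_recl big_ord_recr /= {1}/D eqxx cards1 mul1n.
  rewrite {2}/D /= /bump /= add1n eqxx cards1 muln1.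
  rewrite -[k in RHS]card_ord -prod_nat_const; apply: eq_bigr => i _.
  rewrite /D /= /bump /= add1n eqSS (_ : (i == k :> nat) = false) ?cardsT //.
  by apply/eqP => E; have := ltn_ord i; rewrite E ltnn.
apply/setP => v; rewrite !inE; apply/andP/forallP => [[/eqP va /eqP vb] i|h].
  rewrite /D; case: eqP => [i0|_].
    by rewrite inE -va; apply/eqP; congr (v _ _); apply: val_inj.
  case: eqP => [i1|_]; last by rewrite inE.
  by rewrite inE -vb; apply/eqP; congr (v _ _); apply: val_inj.
by have := h ord0; have := h ord_max; rewrite /D /= eqxx !inE => -> ->.
Qed.

(** These vectors represent [q ^ j] projective points off the hyperplanes of the extremal system,
    the source of the floor term when [m = j + 3]. *)
Lemma card_center j :
  #|[set v : 'rV[F]_j.+4 | (v 0 ord_max != 0) && [forall i : 'I_j.+4, (i < 3)%N ==> (v 0 i == 0)]]|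
  = ((q - 1) * q ^ j)%N.
Proof.
pose D (i : 'I_j.+4) : {set F} :=
  if (i < 3)%N then [set 0] else if i == j.+3 :> nat then [set a | a != 0] else setT.
rewrite (_ : [set v | _] = [set v : 'rV[F]_j.+4 | [forall i, v 0 i \in D i]]).
  rewrite card_row_box 3!big_ord_recl big_ord_recr /= {1 2 3}/D /= cards1 !mul1n.
  rewrite {2}/D /= /bump /= !add1n eqxx card_nonzero mulnC; congr (_ * _)%N.
  rewrite -[j in RHS]card_ord -prod_nat_const; apply: eq_bigr => i _.
  rewrite /D /= /bump /= !add1n !eqSS (_ : (i == j :> nat) = false) ?cardsT //.
  by apply/eqP => E; have := ltn_ord i; rewrite E ltnn.
apply/setP => v; rewrite !inE; apply/andP/forallP => [[va /forallP vb] i|h].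
  rewrite /D; case: ifP => [i3|_]; first by have := vb i; rewrite i3 inE.
  case: eqP => [i1|_]; last by rewrite inE.
  by rewrite inE (_ : i = ord_max) //; apply: val_inj.
split; first by have := h ord_max; rewrite /D /= eqxx inE.
by apply/forallP => i; apply/implyP => i3; have := h i; rewrite /D i3 inE.
Qed.

(* The hyperplanes [x_m = c x_0] meet in a subspace of codimension 2 and, if
   [m > 2], leave out [q ^ (m - 3)] points of [x_0 = x_1 = x_2 = 0]; for [m = 2]
   the two coordinates [x_m] and [x_2] coincide and that locus is empty. *)
Definition plane_product k (S : {set F}) : {mpoly F[k.+2]} :=
  \prod_(c in S) ('X_ord_max - c *: 'X_ord0).

Lemma mval_plane_product k S (v : 'rV[F]_k.+2) :
  mval (plane_product k S) v = \prod_(c in S) (v 0 ord_max - c * v 0 ord0).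
Proof.
rewrite /mval rmorph_prod /=; apply: eq_bigr => c _.
by rewrite mevalB mevalZ !mevalXU.
Qed.

Lemma plane_product_homog k S : plane_product k S \is #|S|.-homog.
Proof.
rewrite -sum1_card /plane_product.
apply: (big_rec2 (fun (p : {mpoly F[k.+2]}) (d : nat) => p \is d.-homog)) => [|c p d _ hp].
  exact: dhomog1.
apply: dhomogM hp; apply: rpredB; first by rewrite dhomogX; apply/eqP; exact: mdeg1.
by apply: rpredZ; rewrite dhomogX; apply/eqP; exact: mdeg1.
Qed.

Lemma plane_product_neq0 k S : plane_product k S != 0.
Proof.
apply/negP => /eqP G0.
have := mval_plane_product S (delta_mx 0 ord_max : 'rV[F]_k.+2).
rewrite G0 /mval meval0 => /esym /eqP /prodf_eq0 [c _].
by rewrite !mxE !eqxx /= mulr0 subr0 oner_eq0.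
Qed.

Lemma card_zeros_plane_product k (S : {set F}) : S != set0 ->
  #|[set v : 'rV[F]_k.+2 | mval (plane_product k S) v == 0%R]|
    = (q ^ k * (1 + (q - 1) * #|S|))%N.
Proof.
case/set0Pn => c0 c0S.
(* [T] lists the pairs of first and last coordinates of the zeros; the [k] coordinates in between
   are free. *)
pose T := (0, 0) |: [set (x.1, x.2 * x.1) | x in setX [set a : F | a != 0] S].
have T0 : (0, 0) \notin [set (x.1, x.2 * x.1) | x in setX [set a : F | a != 0] S].
  by apply/imsetP => -[[a c]] /=; rewrite !inE /= => /andP[a0 _] [E]; rewrite -E eqxx in a0.
have cT : #|T| = (1 + (q - 1) * #|S|)%N.
  rewrite cardsU1 T0 card_in_imset ?cardsX ?card_nonzero //.
  move=> [a c] [a' c']; rewrite !inE /= => /andP[a0 _] _ [<-] /eqP.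
  by rewrite (inj_eq (mulIf a0)) => /eqP ->.
pose f (v : 'rV[F]_k.+2) := (v 0 ord0, v 0 ord_max).
rewrite -sum1_card (partition_big f (mem T)) /=.
  rewrite -cT mulnC -sum_nat_const; apply: eq_bigr => -[a b] abT.
  rewrite -(card_ends k a b) sum1_card; apply: eq_card => v.
  rewrite unfold_in /= !inE xpair_eqE andb_idl // => /andP[/eqP va /eqP vb].
  rewrite mval_plane_product va vb; move: abT; rewrite !inE xpair_eqE.
  case/orP => [/andP[/eqP -> /eqP ->]|/imsetP [[a' c]]].
    by rewrite (bigD1 c0) //= mulr0 subrr mul0r eqxx.
  rewrite !inE /= => /andP[_ cS] [-> ->]; rewrite (bigD1 c) //= subrr mul0r eqxx //.
move=> v; rewrite inE mval_plane_product => /prodf_eq0 [c cS].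
rewrite subr_eq0 => /eqP vc; rewrite /f vc !inE xpair_eqE.
have [v0|v0] := eqVneq (v 0 ord0) 0; first by rewrite v0 mulr0 eqxx.
by apply/orP; right; apply/imsetP; exists (v 0 ord0, c); rewrite // !inE v0.
Qed.

Lemma exists_plane_system k (S : {set F}) :
  exists f : 3.-tuple (dhomog k.+2 F #|S|.+1),
    forall i, tnth f i = 'X_(inord i) * plane_product k S :> {mpoly F[k.+2]}.
Proof.
have hom (i : 'I_3) : 'X_(inord i) * plane_product k S \is #|S|.+1.-homog.
  apply: (@dhomogM _ _ _ 1) (plane_product_homog k S).
  by rewrite dhomogX; apply/eqP; exact: mdeg1.
by exists [tuple DHomog (hom i) | i < 3] => i; rewrite tnth_mktuple.
Qed.

Section PlaneSystem.
Variables (k : nat) (S : {set F}) (f : 3.-tuple (dhomog k.+3 F #|S|.+1)).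
Hypothesis fE : forall i, tnth f i = 'X_(inord i) * plane_product k.+1 S :> {mpoly F[k.+3]}.

Lemma free_plane_system : free f.
Proof.
apply/freeP => c c0 j.
have : (\sum_(i < 3) c i *: 'X_(inord i)) * plane_product k.+1 S = 0 :> {mpoly F[k.+3]}.
  move/(congr1 (@mpoly_of_dhomog _ _ _)): c0; rewrite linear_sum /=; apply: etrans.
  rewrite mulr_suml; apply: eq_bigr => i _.
  by rewrite -tnth_nth fE scalerAl.
move/eqP; rewrite mulf_eq0 (negbTE (plane_product_neq0 _ _)) orbF => /eqP.
(* After cancelling the common factor, evaluation at the [j]-th unit vector isolates [c j]. *)
move/(congr1 (fun p => p.@[fun i => ((i == inord j) : nat)%:R])).
rewrite meval0 raddf_sum /= (bigD1 j) //= big1 => [|i ij].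
  by rewrite mevalZ mevalXU eqxx mulr1 addr0.
rewrite mevalZ mevalXU (_ : (inord i == inord j) = false) ?mulr0 //.
have lt3 (l : 'I_3) : (l < k.+3)%N by apply: leq_trans (ltn_ord l) _.
apply/negP => /eqP /(congr1 (@nat_of_ord _)); rewrite !inordK //.
by move/val_inj => E; rewrite E eqxx in ij.
Qed.

Lemma leq_card_zset_plane_system : S != set0 ->
  (cone_bound q k.+1 #|S|.+1 3 <= #|zset (span_of f)|)%N.
Proof.
move=> S0; rewrite /cone_bound subSS subn0 -card_zeros_plane_product //.
have sub0 : [set v : 'rV[F]_k.+3 | mval (plane_product k.+1 S) v == 0] \subset zset (span_of f).
  apply/subsetP => v; rewrite inE => /eqP Gv; rewrite zset_span_of.
  by apply/forallP => i; rewrite fE /mval mevalM -/(mval (plane_product k.+1 S) v) Gv mulr0.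
rewrite /codim_card; case: (leqP 3 k.+2) => [k1|_]; last first.
  by rewrite muln0 addn0 subset_leq_card.
case: k f fE sub0 k1 => [//|j] g gE sub0 _.
rewrite !subSS subn0 -card_center.
set Z0 := [set v | mval _ v == 0] in sub0 *; set Z1 := [set v | _ && _].
have dis : [disjoint Z0 & Z1].
  apply/pred0P => v; apply/negP => /andP[]; rewrite !inE mval_plane_product.
  case/prodf_eq0 => c _ vc /andP[vm /forallP /(_ ord0) /= v0].
  by move: vc; rewrite (eqP v0) mulr0 subr0 (negbTE vm).
have [_] := leq_card_setU Z0 Z1; rewrite dis => /eqP <-.
apply: subset_leq_card; rewrite subUset sub0 /=; apply/subsetP => v.
rewrite inE zset_span_of => /andP[_ /forallP vi]; apply/forallP => i.
have hi : (inord i : 'I_j.+4) = i :> nat by rewrite inordK // (leq_trans (ltn_ord i)).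
have := vi (inord i); rewrite hi ltn_ord /= => /eqP v0.
by rewrite gE /mval mevalM mevalXU v0 mul0r.
Qed.

End PlaneSystem.

(** The value in the theorem for [m = k + 1], in natural numbers; the sum is [p_(m-2)], empty for
    [k = 0]. *)
Definition max_zeros q k d :=
  ((d - 1) * q ^ k + \sum_(i < k) q ^ i + codim_card q k.+1 3)%N.

Lemma cone_bound3 k d : cone_bound q k d 3 = (1 + (q - 1) * max_zeros q k d)%N.
Proof.
rewrite /max_zeros /cone_bound !mulnDr addnA; congr (_ + _)%N.
rewrite [((q - 1) * \sum_(_ < _) _)%N](_ : _ = (q ^ k - 1)%N); last first.
  by rewrite !subn1 predn_exp.
have : (0 < q ^ k)%N by rewrite expn_gt0 q_gt0.
rewrite muln1 mulnCA [((d - 1) * _)%N]mulnC; lia.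
Qed.

Lemma floor_expz_neg : Num.floor ((q%:R : rat) ^ (2%:Z - 3)) = 0.
Proof.
have q0 : (1 : rat) < q%:R by rewrite ltr1n q_gt1.
apply/eqP; rewrite floor_eq /= (_ : 2%:Z - 3 = -1) // exprN1 add0r.
by rewrite invr_ge0 ler0n invf_lt1 // (lt_trans ltr01).
Qed.

Lemma max_zerosE k d :
  ((d - 1) * q ^ (k.+2 - 1))%N%:Z + (psum q (k.+2%:Z - 2))%:Z
     + Num.floor ((q%:R : rat) ^ (k.+2%:Z - 3)) = (max_zeros q k.+1 d)%:Z.
Proof.
rewrite /max_zeros !PoszD; congr (_ + _ + _).
  by rewrite (_ : k.+2%:Z - 2 = k%:Z) //; lia.
case: k => [|k]; first by rewrite floor_expz_neg.
rewrite (_ : k.+3%:Z - 3 = k%:Z); last by lia.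
by rewrite /codim_card !subSS subn0 -exprnP -natrX pmulrn intrKfloor.
Qed.

End Systems.

Theorem theorem3p1 (F : finFieldType) (m d : nat)
    (hm : (1 < m)%N) (hd1 : (1 < d)%N) (hd2 : (d < #|F| - 1)%N) :
  is_max_common_zeros F m d 3
    (((d - 1) * #|F| ^ (m - 1))%N%:Z + (psum #|F| (m%:Z - 2))%:Z
     + Num.floor ((#|F|%:R : rat) ^ (m%:Z - 3))).
Proof.
case: m hm => [//|[//|k]] _.
have dq : (d.+1 < #|F|)%N by lia.
rewrite max_zerosE; case: d hd1 dq {hd2} => [//|d] d1 dq.
have q1 : (0 < #|F| - 1)%N by rewrite subn_gt0 (leq_trans _ dq).
have upper (f : 3.-tuple (dhomog k.+3 F d.+1)) : free f ->
    (#|common_zeros f| <= max_zeros #|F| k.+1 d.+1)%N.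
  move=> ff; have dW := dim_span_of (ltnW dq) ff.
  have := @card_zset_cone F k.+1 d.+1 (span_of f) d1 dq (@forms_span_of _ _ _ _ f).
  by rewrite dW cone_bound3 card_zset_span_of leq_add2l leq_pmul2l // => ->.
split=> [|f /upper]; last by rewrite lez_nat.
(* The degree is now written [d.+1], so [d] is the number of hyperplanes in the extremal system, one
   for each slope in [S]. *)
have [S cS] : exists S : {set F}, #|S| = d.
  exists [set x in take d (enum F)].
  rewrite cardsE; have /card_uniqP -> : uniq (take d (enum F)) by rewrite take_uniq ?enum_uniq.
  by rewrite size_takel // -cardE; apply: leq_trans (ltnW dq); rewrite !leqW.
subst d; have [f fE] := exists_plane_system k.+1 S.
have ff := free_plane_system fE.
exists f => //; apply/eqP; rewrite eqz_nat eqn_leq upper //=.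
have S0 : S != set0 by rewrite -card_gt0.
have := leq_card_zset_plane_system fE S0.
by rewrite cone_bound3 card_zset_span_of leq_add2l leq_pmul2l.
Qed.
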